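(* The scalar curvature of the separable Kähler geometry $(g_\beta,\omega_\beta,J_\beta)$ associated with a Segre–Veronese factorization structure, an element $\beta\in\mathfrak h$ and functions $A_{ir}$ (as described in the context) is $$-\sum_{i=1}^k\sum_{r=1}^{d_i}\frac{\langle\mu,\beta\rangle^{m+2}}{\Delta_{ir}\,\langle\hat{\mathbf x}_i,\Gamma_i\rangle\left(\prod_{p=1}^k\langle\hat{\mathbf x}_p,\Gamma_p\rangle^{d_p}\right)}\;\partial_{x_{ir}}^2\left(\frac{A_{ir}(x_{ir})}{\langle\mu,\beta\rangle^{m+1}}\prod_{j=1}^k\langle\hat{\mathbf x}_j,\Gamma_j\rangle^{d_j}\right),$$ and the geometry is extremal if and only if there exists $\alpha\in\mathfrak h$ such that $$\sum_{i=1}^k\sum_{r=1}^{d_i}\frac{\langle\mu,\beta\rangle^{m+3}}{\Delta_{ir}\,\langle\hat{\mathbf x}_i,\Gamma_i\rangle\left(\prod_{p=1}^k\langle\hat{\mathbf x}_p,\Gamma_p\rangle^{d_p}\right)}\;\partial_{x_{ir}}^2\left(\frac{A_{ir}(x_{ir})}{\langle\mu,\beta\rangle^{m+1}}\prod_{j=1}^k\langle\hat{\mathbf x}_j,\Gamma_j\rangle^{d_j}\right)=\langle\mu,\alpha\rangle .$$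
   Context: Segre–Veronese factorization structure. Let $m=d_1+\cdots+d_k$ be a partition of an integer $m\ge2$ ($d_j\ge1$), and let $W_1,\dots,W_k$ be 2-dimensional real vector spaces. Put $V^*=\bigotimes_{i=1}^k(W_i^* )^{\otimes d_i}$; tensor slots are labelled by pairs $(i,r)$, $1\le r\le d_i$. Let $\mathrm{ins}_j:(W_j^* )^{\otimes d_j}\otimes\bigotimes_{i\ne j}(W_i^* )^{\otimes d_i}\to V^*$ be the linear map which reorders factors, putting the first $d_j$ factors into the slots $(j,1),\dots,(j,d_j)$. Let $\Gamma_j\in\bigotimes_{r\ne j}(W_r^* )^{\otimes d_r}$, $j=1,\dots,k$, be non-zero tensors (defining tensors) such that $\mathfrak h:=\sum_{j=1}^k\mathrm{ins}_j\big(S^{d_j}W_j^*\otimes\langle\Gamma_j\rangle\big)$ has dimension $m+1$ ($S^dW^*$ = symmetric tensors). The inclusion $\varphi:\mathfrak h\hookrightarrow V^*$ is the factorization structure. For $k=1$ (Veronese case) $\mathfrak h=S^mW^*$ and $\Gamma_1=1$. Notation. Fix bases so that $W_i\cong\mathbb R^2$, $W_i^*\cong\mathbb R^2$ with $\langle(u,v),(a,b)\rangle=ua+vb$. Let $x_{ir}$ ($1\le i\le k$, $1\le r\le d_i$) be real variables, $\mathbf x=\bigotimes_{i}\bigotimes_{r}(1,x_{ir})\in V$, $\hat{\mathbf x}_i=\bigotimes_{j\ne i}\bigotimes_{s=1}^{d_j}(1,x_{js})$ (so $\langle\hat{\mathbf x}_1,\Gamma_1\rangle=1$ if $k=1$),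 $\mu=\varphi^t\mathbf x\in\mathfrak h^*$, i.e. $\langle\mu,\alpha\rangle=\langle\mathbf x,\varphi(\alpha)\rangle$ for $\alpha\in\mathfrak h$, $\mu_\beta=\mu/\langle\mu,\beta\rangle$, $\Delta_{ir}=\prod_{s\ne r}(x_{ir}-x_{is})$ ($=1$ if $d_i=1$), and $\psi_{ir}(x)\in\mathfrak h$ the element with $\varphi(\psi_{ir}(x))=\mathrm{ins}_i\big((x,-1)^{\otimes d_i}\otimes\Gamma_i\big)$. Geometry. Fix $0\ne\beta\in\mathfrak h$, $\mathfrak t=\mathfrak h/\langle\beta\rangle$. Let $x_{ir}$ range over open intervals $I_{ir}$ on whose product all $\Delta_{ir}$, $\langle\hat{\mathbf x}_i,\Gamma_i\rangle$, $\langle\mu,\beta\rangle$ are non-vanishing, and let $A_{ir}$ be smooth non-vanishing functions on $I_{ir}$. Let $dt$ be the exact $\mathfrak t$-valued 1-form of the angular coordinates $t\in\mathfrak t$ (so $(x_{ir},t)$ are coordinates on a $2m$-dimensional manifold); note $\partial_{x_{ir}}\mu_\beta$ is valued in the annihilator of $\beta$, identified with $\mathfrak t^*$. The separable Kähler geometry is $$g_\beta=\sum_{i,r}\Big(\tfrac{\Delta_{ir}\langle\hat{\mathbf x}_i,\Gamma_i\rangle}{A_{ir}(x_{ir})\langle\mu,\beta\rangle}dx_{ir}^2+\tfrac{A_{ir}(x_{ir})\langle\mu,\beta\rangle}{\Delta_{ir}\langle\hat{\mathbf x}_i,\Gamma_i\rangle}\langle\partial_{x_{ir}}\mu_\beta,dt\rangle^2\Big),\quad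 \omega_\beta=\sum_{i,r}dx_{ir}\wedge\langle\partial_{x_{ir}}\mu_\beta,dt\rangle,$$ $$J_\beta dx_{ir}=\tfrac{A_{ir}(x_{ir})\langle\mu,\beta\rangle}{\Delta_{ir}\langle\hat{\mathbf x}_i,\Gamma_i\rangle}\langle\partial_{x_{ir}}\mu_\beta,dt\rangle,\quad J_\beta dt=\sum_{i,r}\tfrac{\psi_{ir}(x_{ir})\ \mathrm{mod}\ \beta}{A_{ir}(x_{ir})}dx_{ir},$$ with the $A_{ir}$ such that $g_\beta$ is positive definite. A Kähler metric is extremal if its scalar curvature is a Killing potential, i.e. $J\,\mathrm{grad}(\mathrm{Scal})$ is a Killing vector field. *)

(* Defs.v *)
From HB Require Import structures.
From mathcomp Require Import all_boot all_order all_algebra all_fingroup.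
From mathcomp Require Import all_classical all_reals all_analysis.

Set Implicit Arguments.
Unset Strict Implicit.
Unset Printing Implicit Defensive.

Import Order.TTheory GRing.Theory Num.Theory.
Import numFieldNormedType.Exports.

Local Open Scope classical_set_scope.
Local Open Scope ring_scope.

(* ------------------------------------------------------------------------ *)
(* Tensors.  The tensor product of copies of R^2 (or of its dual) over a    *)
(* finite set S of slots is its coordinate space in the standard basis: a   *)
(* tensor assigns a real number to every multi-index S -> {0, 1}.  V and    *)
(* V^* share this model and are paired by `tpair`.                          *)
(* ------------------------------------------------------------------------ *)

Section Tensors.
Variable R : realType.

Definition vec2 (u v : R) (c : 'I_2) : R := if c == ord0 then u else v.

Definition tensor (S : finType) := {ffun {ffun S -> 'I_2} -> R^o}.

Definition pure (S : finType) (w : S -> 'I_2 -> R) : tensor S :=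
  [ffun e : {ffun S -> 'I_2} => \prod_s w s (e s)].

Definition tpair (S : finType) (v a : tensor S) : R := \sum_e v e * a e.

Definition permute_slots n (s : 'S_n) (T : tensor 'I_n) : tensor 'I_n :=
  [ffun e : {ffun 'I_n -> 'I_2} => T [ffun r => e (s r)]].

Fact permute_slots_is_linear n (s : 'S_n) : linear (permute_slots s).
Proof. by move=> a T U; apply/ffunP => e; rewrite !ffunE. Qed.

HB.instance Definition _ n (s : 'S_n) :=
  GRing.isLinear.Build R (tensor 'I_n) (tensor 'I_n) _ (permute_slots s)
    (permute_slots_is_linear s).

Definition symtensors n : {vspace tensor 'I_n} :=
  (\bigcap_(s : 'S_n) fixedSpace (linfun (permute_slots s)))%VS.

End Tensors.

(* ------------------------------------------------------------------------ *)
(* Segre-Veronese factorization structures.                                 *)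
(* ------------------------------------------------------------------------ *)

(* The label (i, r) is `Tagged _ r : slot d` with r : 'I_(d i).             *)
Definition slot k (d : 'I_k -> nat) : finType := {i : 'I_k & 'I_(d i)}.

Definition offslot k (d : 'I_k -> nat) (j : 'I_k) : finType :=
  {s : slot d | tag s != j}.

Section SegreVeronese.
Variables (R : realType) (k : nat) (d : 'I_k -> nat).

(* `ins G T` is ins_j (T (x) G).                                            *)
Definition ins j (G : tensor R (offslot d j)) (T : tensor R 'I_(d j)) :
    tensor R (slot d) :=
  [ffun e : {ffun slot d -> 'I_2} =>
     T [ffun r => e (Tagged (fun i => 'I_(d i)) r)] * G [ffun s => e (val s)]].

Fact ins_is_linear j (G : tensor R (offslot d j)) : linear (ins G).
Proof.
move=> a T U; apply/ffunP => e; rewrite !ffunE mulrDl.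
by congr (_ + _); rewrite /GRing.scale /= mulrA.
Qed.

HB.instance Definition _ j (G : tensor R (offslot d j)) :=
  GRing.isLinear.Build R (tensor R 'I_(d j)) (tensor R (slot d)) _ (ins G)
    (ins_is_linear G).

Variable Gam : forall j, tensor R (offslot d j).

(* The space h, as a subspace of V^*; the map phi is the inclusion, so      *)
(* elements of h are represented by elements of V^*.                        *)
Definition fact_space : {vspace tensor R (slot d)} :=
  (\sum_(j < k) (linfun (ins (Gam j)) @: symtensors R (d j)))%VS.

(* <mu, alpha> at the point x, for alpha in h.                              *)
Definition mu (x : slot d -> R) (alpha : tensor R (slot d)) : R :=
  tpair (pure (fun s => vec2 1 (x s))) alpha.

(* <x^_j, Gamma_j>                                                          *)
Definition xGam (x : slot d -> R) (j : 'I_k) : R :=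
  tpair (pure (fun s : offslot d j => vec2 1 (x (val s)))) (Gam j).

Definition Delta (x : slot d -> R) (s : slot d) : R :=
  \prod_(s' : slot d | (tag s' == tag s) && (s' != s)) (x s - x s').

Definition psi (i : 'I_k) (y : R) : tensor R (slot d) :=
  ins (Gam i) (pure (fun _ => vec2 y (- 1))).

End SegreVeronese.

(* ------------------------------------------------------------------------ *)
(* Riemannian geometry in a coordinate chart.  Points are coordinate        *)
(* vectors I -> R over a finite index type I of coordinates.                *)
(* ------------------------------------------------------------------------ *)

Section Chart.
Variables (R : realType) (I : finType).

Definition pderiv (J : eqType) (c : J) (f : (J -> R) -> R) (p : J -> R) : R :=
  derive1 (fun t : R => f (@dfwith J (fun _ => R) p c t)) (p c).

(* Fields of bilinear forms or of matrices, and vector fields.              *)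
Definition field2 := (I -> R) -> I -> I -> R.
Definition vfield := (I -> R) -> I -> R.

Implicit Types (g : field2) (X : vfield) (f : (I -> R) -> R).

Definition posdef g (p : I -> R) : Prop :=
  forall v : I -> R, (exists a, v a != 0) ->
    0 < \sum_a \sum_b v a * g p a b * v b.

(* g^{ab}                                                                   *)
Definition inv_metric g : field2 := fun p a b =>
  invmx (\matrix_(i < #|I|, j < #|I|) g p (enum_val i) (enum_val j))
    (enum_rank a) (enum_rank b).

(* Levi-Civita: `christoffel g c a b` is Gamma^c_{ab}.                      *)
Definition christoffel g (c a b : I) (p : I -> R) : R :=
  2^-1 * \sum_e inv_metric g p c e *
    (pderiv a (fun q => g q b e) p + pderiv b (fun q => g q a e) p
     - pderiv e (fun q => g q a b) p).

(* `riemann g l c a b` is R^l_{cab}, the components of                      *)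
(* R(d_a, d_b) d_c = nabla_a nabla_b d_c - nabla_b nabla_a d_c.             *)
Definition riemann g (l c a b : I) (p : I -> R) : R :=
  pderiv a (christoffel g l b c) p - pderiv b (christoffel g l a c) p
  + \sum_e (christoffel g l a e p * christoffel g e b c p
            - christoffel g l b e p * christoffel g e a c p).

Definition ricci g (c b : I) (p : I -> R) : R := \sum_a riemann g a c a b p.

Definition scal g (p : I -> R) : R :=
  \sum_b \sum_c inv_metric g p b c * ricci g b c p.

Definition grad g f : vfield := fun p a =>
  \sum_b inv_metric g p a b * pderiv b f p.

(* L_X g = 0 on D                                                           *)
Definition killing (D : set (I -> R)) g X : Prop :=
  forall p, D p -> forall a b,
    \sum_c (X p c * pderiv c (fun q => g q a b) p
            + g p c b * pderiv a (fun q => X q c) p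
            + g p a c * pderiv b (fun q => X q c) p) = 0.

(* A metric, a 2-form and an almost complex structure J, the latter given   *)
(* by its action on 1-forms: J dz_b = \sum_c (cplx p b c) dz_c.             *)
Record hermitian_data := HermitianData {
  metric : field2;
  kform : field2;
  cplx : field2 }.

(* J on vectors, with (J theta)(X) = - theta (J X): this is the convention  *)
(* compatible with the identification of vectors and 1-forms by the metric. *)
Definition cplx_vect (K : hermitian_data) X : vfield := fun p b =>
  - \sum_c cplx K p b c * X p c.

Definition extremal (D : set (I -> R)) (K : hermitian_data) : Prop :=
  killing D (metric K) (cplx_vect K (grad (metric K) (scal (metric K)))).

End Chart.

(* ------------------------------------------------------------------------ *)
(* The separable geometry.  If (beta, e_1, ..., e_m) is a basis of h, the   *)
(* classes [e_a] form a basis of t = h / <beta>, with linear coordinates    *)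
(* t_a, so that dt = \sum_a dt_a [e_a] and, for xi in the annihilator of    *)
(* beta, <xi, dt> = \sum_a <xi, e_a> dt_a.  The coordinates of the          *)
(* 2m-manifold are indexed by slot d + 'I_m: `inl s` is x_s, `inr a` is     *)
(* t_a.                                                                     *)
(* ------------------------------------------------------------------------ *)

Section Separable.
Variables (R : realType) (k : nat) (d : 'I_k -> nat) (m : nat).
Variable Gam : forall j, tensor R (offslot d j).
Variables (beta : tensor R (slot d)) (e : m.-tuple (tensor R (slot d))).
Variable A : slot d -> R -> R.

Definition coords : finType := (slot d + 'I_m)%type.

Definition xpart (p : coords -> R) : slot d -> R := fun s => p (inl s).

Definition dx (s : slot d) (c : coords) : R := (c == inl s)%:R.

(* The components of the 1-form <d_{x_s} mu_beta, dt>.                      *)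
Definition theta (x : slot d -> R) (s : slot d) (c : coords) : R :=
  match c with
  | inl _ => 0
  | inr a => pderiv s (fun y => mu y (tnth e a) / mu y beta) x
  end.

(* The coordinate of v in h, modulo beta, along [e_a].                      *)
Definition coord_mod_beta (a : 'I_m) (v : tensor R (slot d)) : R :=
  coord [tuple of beta :: e] (lift ord0 a) v.

Definition sep_metric : field2 R coords := fun p b c =>
  let x := xpart p in
  \sum_s (Delta x s * xGam Gam x (tag s) / (A s (x s) * mu x beta)
            * (dx s b * dx s c)
          + A s (x s) * mu x beta / (Delta x s * xGam Gam x (tag s))
            * (theta x s b * theta x s c)).

Definition sep_form : field2 R coords := fun p b c =>
  let x := xpart p in
  \sum_s (dx s b * theta x s c - theta x s b * dx s c).

Definition sep_cplx : field2 R coords := fun p b c =>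
  let x := xpart p in
  match b with
  | inl s => A s (x s) * mu x beta / (Delta x s * xGam Gam x (tag s))
               * theta x s c
  | inr a => \sum_s coord_mod_beta a (psi Gam (tag s) (x s)) / A s (x s)
               * dx s c
  end.

Definition sep_geometry : hermitian_data R coords :=
  HermitianData sep_metric sep_form sep_cplx.

Definition sep_domain (I : slot d -> set R) : set (coords -> R) :=
  [set p | forall s, I s (xpart p s)].

End Separable.

Definition smooth_on (R : realType) (U : set R) (f : R -> R) : Prop :=
  forall n x, U x -> derivable (derive1n n f) x 1.

(* Main.v *)
Require Import Defs.
From mathcomp Require Import all_boot all_order all_algebra all_fingroup.
From mathcomp Require Import all_classical all_reals all_analysis.
From mathcomp Require Import ring.
Import Order.TTheory GRing.Theory Num.Theory.
Import numFieldNormedType.Exports.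
Local Open Scope classical_set_scope.
Local Open Scope ring_scope.

(**
The metric depends on x only: it is diag(b) + H dt dt, where H = P^T diag(1/b) P,
b_s = Delta_s <x^_s, Gamma_s> / (A_s <mu, beta>) and P_sa is the x_s-derivative of
f_a = <mu_beta, e_a>.  Expanding psi_t(x_t) in the basis (beta, e) inverts P and
reduces, by linearity in h, the second derivatives of the f_a to those of the
affine coordinates of psi_t.  This yields, with l_su = d_s log b_u and
kappa_s = - 2 d_s log <mu, beta>,
  d_s P_u = l_su P_u + l_us P_s  (u <> s),    d_s P_s = kappa_s P_s,
and d_s d_s b_u = kappa_s d_s b_u for u <> s, b_u being then a quotient of affine functions of x_s.
The traces of the Ricci tensor over the x-block and over the t-block are then equal, and
  Scal = - sum_s (d_s (tau_s / b_s) + lam_s tau_s / b_s),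
where lam_s and tau_s are the logarithmic x_s-derivatives of Delta_s Pi / <mu, beta>^(m+1)
and A_s Pi / <mu, beta>^(m+2), Pi being the product of the <x^_j, Gamma_j>^(d_j).
Since <mu, beta> is affine in x_s, each summand collapses to a second derivative.

J grad Scal is tangent to the torus fibres with components that are functions of x, so
it is Killing iff these are constant, iff Scal is an affine function of the f_a.
*)

Set Implicit Arguments.
Unset Strict Implicit.
Unset Printing Implicit Defensive.

(** * Partial derivatives on boxes *)

(** The curvature computation sees the factorization structure only through the invertibility of P
    and the identities for the derivatives of P, b and kappa. They rest on two facts. The pairing
    <mu, psi_t(y)> contains the factor y - x_t once; if y is held fixed during differentiation and
    set to x_t afterwards, only the terms in which this factor has been differentiated survive. As
    there are m slots and the torus has dimension m, testing against all psi_t(x_t) then determines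
    a covector. Moreover, the Wronskian of two functions affine in x_s has zero x_s-derivative;
    applied to their quotient this gives kappa_s. In classical terms tau_s is the logarithmic
    derivative of det H and lam_s that of sqrt(det g), so the formula says Scal = - div grad log det
    H, as for toric Kähler metrics in general. The equality of the two Ricci traces reflects the
    J-invariance of Ricci; here it comes out of a direct computation in the x-coordinates. The
    exponent m + 1 is (m - 1) + 2: each b_u with u <> s carries one factor 1 / <mu, beta>, and
    kappa_s accounts for two. *)

Section PartialDerivatives.
Variables (R : realType) (J : eqType).
Implicit Types (c : J) (x : J -> R) (F G : (J -> R) -> R).

Definition move c x (t : R) : J -> R := @dfwith J (fun=> R) x c t.

(** A record and not a plain definition, so that unification meets [F] itself and does not unfold to
    its restriction to a line. *)
Record pderivable c F x : Prop := Pderivable {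
  pderivable_line : derivable (fun t => F (move c x t) : R^o) (x c) 1 }.

Definition indep c F := forall x t, F (move c x t) = F x.

Lemma moveE c x t j : move c x t j = if j == c then t else x j.
Proof.
rewrite /move; have [->|jc] := eqVneq j c; first exact: dfwithin.
by rewrite dfwithout // eq_sym.
Qed.

Lemma move_id c x : move c x (x c) = x.
Proof. by apply/funext => j; rewrite moveE; case: eqP => // ->. Qed.

Lemma move_move c x t u : move c (move c x t) u = move c x u.
Proof. by apply/funext => j; rewrite !moveE; case: eqP. Qed.

Lemma pderivE c F x : pderiv c F x = 'D_1 (fun t => F (move c x t) : R^o) (x c).
Proof. by rewrite /pderiv derive1E. Qed.

Lemma pderivable_cst c a x : pderivable c (fun=> a) x.
Proof. by split; exact: derivable_cst. Qed.

Lemma pderiv_cst c a x : pderiv c (fun=> a) x = 0.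
Proof. by rewrite pderivE; exact: (derive_cst (a : R^o)). Qed.

Lemma pderivable_coord c s x : pderivable c (fun y => y s) x.
Proof.
split; have [->|sc] := eqVneq s c.
  rewrite (_ : (fun t => _) = id); first exact: derivable_id.
  by apply/funext => t; rewrite moveE eqxx.
rewrite (_ : (fun t => _) = cst (x s)); first exact: derivable_cst.
by apply/funext => t; rewrite moveE (negbTE sc).
Qed.

Lemma pderiv_coord c s x : pderiv c (fun y => y s) x = (s == c)%:R.
Proof.
rewrite pderivE; have [->|sc] := eqVneq s c.
  rewrite (_ : (fun t => _) = id); first exact: derive_id.
  by apply/funext => t; rewrite moveE eqxx.
rewrite (_ : (fun t => _) = cst (x s)); first exact: derive_cst.
by apply/funext => t; rewrite moveE (negbTE sc).
Qed.

Lemma pderivableD c F G x : pderivable c F x -> pderivable c G x ->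
  pderivable c (fun y => F y + G y) x.
Proof. by move=> [dF] [dG]; split; exact: (derivableD dF dG). Qed.

Lemma pderivD c F G x : pderivable c F x -> pderivable c G x ->
  pderiv c (fun y => F y + G y) x = pderiv c F x + pderiv c G x.
Proof. by move=> [dF] [dG]; rewrite !pderivE; exact: (deriveD dF dG). Qed.

Lemma pderivableM c F G x : pderivable c F x -> pderivable c G x ->
  pderivable c (fun y => F y * G y) x.
Proof. by move=> [dF] [dG]; split; exact: (derivableM dF dG). Qed.

Lemma pderivM c F G x : pderivable c F x -> pderivable c G x ->
  pderiv c (fun y => F y * G y) x = pderiv c F x * G x + F x * pderiv c G x.
Proof.
move=> [dF] [dG]; rewrite !pderivE [LHS](deriveM dF dG) /= move_id.
by rewrite addrC /GRing.scale /= [G x * _]mulrC.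
Qed.

Lemma pderivableV c F x : F x != 0 -> pderivable c F x ->
  pderivable c (fun y => (F y)^-1) x.
Proof. by move=> Fx [dF]; split; apply: derivableV; rewrite ?move_id. Qed.

Lemma pderivV c F x : F x != 0 -> pderivable c F x ->
  pderiv c (fun y => (F y)^-1) x = - pderiv c F x / F x ^+ 2.
Proof.
move=> Fx [dF]; rewrite !pderivE [LHS](deriveV _ dF) /= ?move_id //.
by rewrite /GRing.scale /= !mulNr mulrC.
Qed.

Lemma pderivable_indep c F x : indep c F -> pderivable c F x.
Proof.
move=> iF; split; rewrite (_ : (fun t => _) = cst (F x)).
  exact: derivable_cst.
by apply/funext => t; rewrite iF.
Qed.

Lemma pderiv_indep c F x : indep c F -> pderiv c F x = 0.
Proof.
move=> iF; rewrite pderivE (_ : (fun t => _) = cst (F x)); first exact: derive_cst.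
by apply/funext => t; rewrite iF.
Qed.

Lemma pderivableN c F x : pderivable c F x -> pderivable c (fun y => - F y) x.
Proof. by move=> [dF]; split; exact: (derivableN dF). Qed.

Lemma pderivN c F x : pderivable c F x ->
  pderiv c (fun y => - F y) x = - pderiv c F x.
Proof. by move=> [dF]; rewrite !pderivE; exact: (deriveN dF). Qed.

Lemma pderivableZ c a F x : pderivable c F x -> pderivable c (fun y => a * F y) x.
Proof. by apply: pderivableM; exact: pderivable_cst. Qed.

Lemma pderivZ c a F x : pderivable c F x ->
  pderiv c (fun y => a * F y) x = a * pderiv c F x.
Proof.
by move=> dF; rewrite pderivM ?pderiv_cst ?mul0r ?add0r //; exact: pderivable_cst.
Qed.

Lemma pderivableB c F G x : pderivable c F x -> pderivable c G x ->
  pderivable c (fun y => F y - G y) x.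
Proof. by move=> dF dG; exact: pderivableD dF (pderivableN dG). Qed.

Lemma pderivB c F G x : pderivable c F x -> pderivable c G x ->
  pderiv c (fun y => F y - G y) x = pderiv c F x - pderiv c G x.
Proof. by move=> dF dG; rewrite (pderivD dF (pderivableN dG)) pderivN. Qed.

Lemma big_cons_fun (op : R -> R -> R) a (K : Type) (r : seq K) (P : pred K)
    (F : K -> (J -> R) -> R) k :
  (fun y => \big[op/a]_(i <- k :: r | P i) F i y)
  = if P k then fun y => op (F k y) (\big[op/a]_(i <- r | P i) F i y)
    else fun y => \big[op/a]_(i <- r | P i) F i y.
Proof. by apply/funext => y; rewrite big_cons; case: (P k). Qed.

Lemma big_nil_fun (op : R -> R -> R) a (K : Type) (P : pred K)
    (F : K -> (J -> R) -> R) :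
  (fun y => \big[op/a]_(i <- [::] | P i) F i y) = fun=> a.
Proof. by apply/funext => y; rewrite big_nil. Qed.

Lemma pderivable_sum c (K : Type) (r : seq K) (P : pred K) (F : K -> (J -> R) -> R) x :
  (forall k, P k -> pderivable c (F k) x) ->
  pderivable c (fun y => \sum_(k <- r | P k) F k y) x.
Proof.
move=> dF; elim: r => [|k r IH]; first by rewrite big_nil_fun; exact: pderivable_cst.
by rewrite big_cons_fun; case: ifPn => // Pk; exact: pderivableD (dF k Pk) IH.
Qed.

Lemma pderiv_sum c (K : Type) (r : seq K) (P : pred K) (F : K -> (J -> R) -> R) x :
  (forall k, P k -> pderivable c (F k) x) ->
  pderiv c (fun y => \sum_(k <- r | P k) F k y) x
  = \sum_(k <- r | P k) pderiv c (F k) x.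
Proof.
move=> dF; elim: r => [|k r IH]; first by rewrite big_nil_fun big_nil pderiv_cst.
rewrite big_cons_fun big_cons; case: ifPn => // Pk.
by rewrite (pderivD (dF k Pk) (pderivable_sum r dF)) IH.
Qed.

End PartialDerivatives.

(** * Products of open sets, and smoothness on them *)

Section Box.
Variables (R : realType) (J : eqType) (I : J -> set R).
Hypothesis open_I : forall s, open (I s).
Implicit Types (c : J) (x : J -> R) (F G : (J -> R) -> R).

Definition box : set (J -> R) := [set x | forall s, I s (x s)].

Lemma box_move c x t : box x -> I c t -> box (move c x t).
Proof. by move=> bx It s; rewrite moveE; case: eqP => // ->. Qed.

Lemma near_box c x : box x -> \forall t \near (x c : R^o), box (move c x t).
Proof.
move=> bx; have /open_nbhs_nbhs : open_nbhs (x c : R^o) (I c) by split; [exact: open_I|].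
by apply: filterS => t; exact: box_move.
Qed.

(** The sides being open, both functions agree near the point on the coordinate line; their values
    outside the box never matter. *)
Lemma pderiv_eq_box c F G x : (forall y, box y -> F y = G y) -> box x ->
  pderiv c F x = pderiv c G x.
Proof.
move=> FG bx; rewrite !pderivE; apply: near_eq_derive.
by apply: filterS (near_box c bx) => t; exact: FG.
Qed.

Lemma pderivable_eq_box c F G x : (forall y, box y -> F y = G y) -> box x ->
  pderivable c F x -> pderivable c G x.
Proof.
move=> FG bx [dF]; split; apply: (near_eq_derivable _ dF).
by apply: filterS (near_box c bx) => t; exact: FG.
Qed.

(** Differentiability along coordinate lines, for all iterated partial derivatives up to order [n]:
    exactly what [pderiv] can see. *)
Fixpoint psmoothn n F : Prop :=
  if n is n'.+1 then
    forall s, (forall x, box x -> pderivable s F x) /\ psmoothn n' (pderiv s F)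
  else True.

Definition psmooth F := forall n, psmoothn n F.

Lemma psmoothn_eq n F G : (forall y, box y -> F y = G y) ->
  psmoothn n F -> psmoothn n G.
Proof.
elim: n F G => // n IH F G FG sF s; have [dF sF'] := sF s; split=> [x bx|].
  exact: (pderivable_eq_box FG bx (dF x bx)).
by apply: IH sF' => y By; exact: pderiv_eq_box.
Qed.

Lemma psmoothn_le n F : psmoothn n.+1 F -> psmoothn n F.
Proof.
elim: n F => // n IH F sF s; have [dF sF'] := sF s.
by split => //; exact: IH.
Qed.

Lemma psmooth_pderivable F c x : psmooth F -> box x -> pderivable c F x.
Proof. by move=> /(_ 1%N c)[+ _]; apply. Qed.

Lemma psmooth_pderiv F c : psmooth F -> psmooth (pderiv c F).
Proof. by move=> sF n; have [] := sF n.+1 c. Qed.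

Lemma psmooth_cst a : psmooth (fun=> a).
Proof.
move=> n; elim: n a => // n IH a s; split=> [x _|]; first exact: pderivable_cst.
rewrite (_ : pderiv s _ = fun=> 0); first exact: IH.
by apply/funext => x; exact: pderiv_cst.
Qed.

Lemma psmooth_coord s : psmooth (fun y => y s).
Proof.
case=> // n c; split=> [x _|]; first exact: pderivable_coord.
rewrite (_ : pderiv c _ = fun=> (s == c)%:R); first exact: psmooth_cst.
by apply/funext => x; rewrite pderiv_coord.
Qed.

Lemma psmoothnD n F G : psmoothn n F -> psmoothn n G -> psmoothn n (fun y => F y + G y).
Proof.
elim: n F G => // n IH F G sF sG s; have [dF sF'] := sF s; have [dG sG'] := sG s.
split=> [x bx|]; first by apply: pderivableD; [exact: dF|exact: dG].
apply: psmoothn_eq (IH _ _ sF' sG') => y By.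
by rewrite pderivD //; [exact: dF|exact: dG].
Qed.

Lemma psmoothnM n F G : psmoothn n F -> psmoothn n G -> psmoothn n (fun y => F y * G y).
Proof.
elim: n F G => // n IH F G sF sG s; have [dF sF'] := sF s; have [dG sG'] := sG s.
split=> [x bx|]; first by apply: pderivableM; [exact: dF|exact: dG].
apply: psmoothn_eq (psmoothnD (IH _ _ sF' (psmoothn_le sG))
  (IH _ _ (psmoothn_le sF) sG')) => y By.
by rewrite pderivM //; [exact: dF|exact: dG].
Qed.

Lemma psmoothnV n F : (forall y, box y -> F y != 0) ->
  psmoothn n F -> psmoothn n (fun y => (F y)^-1).
Proof.
move=> F0; elim: n => // n IH sF s; have [dF sF'] := sF s.
split=> [x bx|]; first by apply: pderivableV; [exact: F0|exact: dF].
have sV := IH (psmoothn_le sF).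
have sN : psmoothn n (fun y => - 1 * pderiv s F y).
  by apply: psmoothnM => //; exact: psmooth_cst.
apply: psmoothn_eq (psmoothnM sN (psmoothnM sV sV)) => y By.
by rewrite pderivV ?F0 //; [rewrite mulN1r expr2 invfM|exact: dF].
Qed.

Lemma psmoothD F G : psmooth F -> psmooth G -> psmooth (fun y => F y + G y).
Proof. by move=> sF sG n; exact: psmoothnD. Qed.

Lemma psmoothM F G : psmooth F -> psmooth G -> psmooth (fun y => F y * G y).
Proof. by move=> sF sG n; exact: psmoothnM. Qed.

Lemma psmoothV F : (forall y, box y -> F y != 0) -> psmooth F ->
  psmooth (fun y => (F y)^-1).
Proof. by move=> F0 sF n; exact: psmoothnV. Qed.

Lemma psmoothnN n F : psmoothn n F -> psmoothn n (fun y => - F y).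
Proof.
elim: n F => // n IH F sF s; have [dF sF'] := sF s.
split=> [x bx|]; first by apply: pderivableN; exact: dF.
apply: psmoothn_eq (IH _ sF') => y By.
by rewrite pderivN //; exact: dF.
Qed.

Lemma psmoothN F : psmooth F -> psmooth (fun y => - F y).
Proof. by move=> sF n; exact: psmoothnN. Qed.

Lemma psmoothB F G : psmooth F -> psmooth G -> psmooth (fun y => F y - G y).
Proof. by move=> sF sG; apply: psmoothD => //; exact: psmoothN. Qed.

Lemma psmooth_div F G : (forall y, box y -> G y != 0) -> psmooth F -> psmooth G ->
  psmooth (fun y => F y / G y).
Proof. by move=> G0 sF sG; apply: psmoothM => //; exact: psmoothV. Qed.

Lemma psmooth_sum (K : Type) (r : seq K) (P : pred K) (F : K -> (J -> R) -> R) :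
  (forall k, P k -> psmooth (F k)) -> psmooth (fun y => \sum_(k <- r | P k) F k y).
Proof.
move=> sF; elim: r => [|k r IH]; first by rewrite big_nil_fun; exact: psmooth_cst.
by rewrite big_cons_fun; case: ifPn => // Pk; exact: psmoothD (sF k Pk) IH.
Qed.

Lemma psmooth_prod (K : Type) (r : seq K) (P : pred K) (F : K -> (J -> R) -> R) :
  (forall k, P k -> psmooth (F k)) -> psmooth (fun y => \prod_(k <- r | P k) F k y).
Proof.
move=> sF; elim: r => [|k r IH]; first by rewrite big_nil_fun; exact: psmooth_cst.
by rewrite big_cons_fun; case: ifPn => // Pk; exact: psmoothM (sF k Pk) IH.
Qed.

Lemma psmoothX n F : psmooth F -> psmooth (fun y => F y ^+ n).
Proof.
move=> sF; elim: n => [|n IH]; first exact: psmooth_cst.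
rewrite (_ : (fun y => _) = fun y => F y * F y ^+ n); first exact: psmoothM.
by apply/funext => y; rewrite exprS.
Qed.

Lemma psmooth_comp_coord (f : R -> R) s : smooth_on (I s) f -> psmooth (fun y => f (y s)).
Proof.
move=> sf n.
(* Passing to an arbitrary iterated derivative of [f] makes the induction go through:
   differentiating along [s] turns [l] into [l.+1]. *)
have [l ->] : exists l, f = derive1n l f by exists 0%N.
elim: n l => // n IH l c; have [->|cs] := eqVneq c s; last first.
  have iF : indep c (fun y : J -> R => derive1n l f (y s)).
    by move=> x t; rewrite moveE eq_sym (negbTE cs).
  split=> [x _|]; first exact: pderivable_indep.
  rewrite (_ : pderiv c _ = fun=> 0); first exact: psmooth_cst.
  by apply/funext => x; rewrite pderiv_indep.
have E x : (fun t => derive1n l f (move s x t s)) = derive1n l f.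
  by apply/funext => t; rewrite moveE eqxx.
split=> [x bx|]; first by split; rewrite E; exact: sf.
by apply: psmoothn_eq (IH l.+1) => y By; rewrite pderivE E /= -derive1E.
Qed.

End Box.

(** * Logarithmic derivatives *)

Section LogarithmicDerivative.
Variables (R : realType) (J : eqType).
Implicit Types (c : J) (x : J -> R) (F G : (J -> R) -> R).

Definition logd c F x : R := pderiv c F x / F x.

Lemma logdM c F G x : pderivable c F x -> pderivable c G x -> F x != 0 -> G x != 0 ->
  logd c (fun y => F y * G y) x = logd c F x + logd c G x.
Proof. by move=> dF dG F0 G0; rewrite /logd (pderivM dF dG); field; rewrite F0 G0. Qed.

Lemma logdV c F x : pderivable c F x -> F x != 0 ->
  logd c (fun y => (F y)^-1) x = - logd c F x.
Proof. by move=> dF F0; rewrite /logd pderivV //; field. Qed.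

Lemma logd_div c F G x : pderivable c F x -> pderivable c G x -> F x != 0 -> G x != 0 ->
  logd c (fun y => F y / G y) x = logd c F x - logd c G x.
Proof.
move=> dF dG F0 G0; rewrite (logdM dF (pderivableV G0 dG)) ?invr_neq0 //.
by rewrite logdV.
Qed.

Lemma logd_indep c F x : indep c F -> logd c F x = 0.
Proof. by move=> iF; rewrite /logd pderiv_indep // mul0r. Qed.

Lemma pderivable_prod c (K : Type) (r : seq K) (Q : pred K) (F : K -> (J -> R) -> R) x :
  (forall i, Q i -> pderivable c (F i) x) ->
  pderivable c (fun y => \prod_(i <- r | Q i) F i y) x.
Proof.
move=> dF; elim: r => [|i r IH]; first by rewrite big_nil_fun; exact: pderivable_cst.
by rewrite big_cons_fun; case: ifPn => // Qi; exact: pderivableM (dF i Qi) IH.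
Qed.

Lemma logd_prod c (K : eqType) (r : seq K) (Q : pred K) (F : K -> (J -> R) -> R) x :
  (forall i, Q i -> pderivable c (F i) x) -> (forall i, Q i -> F i x != 0) ->
  logd c (fun y => \prod_(i <- r | Q i) F i y) x = \sum_(i <- r | Q i) logd c (F i) x.
Proof.
move=> dF F0; elim: r => [|i r IH].
  by rewrite big_nil_fun big_nil /logd pderiv_cst mul0r.
rewrite big_cons_fun big_cons; case: ifPn => // Qi.
rewrite (logdM (dF i Qi) (pderivable_prod r dF)) ?IH ?F0 //.
by rewrite prodf_seq_neq0; apply/allP => j _; apply/implyP => /F0.
Qed.

Lemma logdX c F n x : pderivable c F x -> F x != 0 ->
  logd c (fun y => F y ^+ n) x = n%:R * logd c F x.
Proof.
move=> dF F0; rewrite (_ : (fun y => _) = fun y => \prod_(i < n) F y).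
  by rewrite logd_prod // sumr_const card_ord mulr_natl.
by apply/funext => y; rewrite prodr_const card_ord.
Qed.

End LogarithmicDerivative.

(** * Curvature of torus-invariant block metrics *)

(** A right inverse of a square matrix is its inverse; the enumeration of the coordinates inside
    [inv_metric] is dealt with here once and for all. *)
Lemma inv_metric_eq (R : realType) (C : finType) (g : field2 R C) (h : C -> C -> R) p :
  (forall a c, \sum_b g p a b * h b c = (a == c)%:R) ->
  forall a b, inv_metric g p a b = h a b.
Proof.
move=> gh a b; rewrite /inv_metric.
set G := \matrix_(i, j) _.
pose H : 'M[R]_#|C| := \matrix_(i, j) h (enum_val i) (enum_val j).
have GH : G *m H = 1%:M.
  apply/matrixP => i j; rewrite !mxE -(inj_eq enum_val_inj) -gh.
  rewrite (reindex_onto (@enum_val C C) (@enum_rank C)); last by move=> c _; rewrite enum_rankK.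
  rewrite (eq_bigl predT) => [|c /=]; last by rewrite enum_valK eqxx.
  by apply: eq_bigr => c _; rewrite !mxE.
have [uG _] := mulmx1_unit GH.
have -> : invmx G = H by rewrite -[RHS](mulKmx uG) GH mulmx1.
by rewrite mxE !enum_rankK.
Qed.

Section TorusInvariant.
Variables (R : realType) (S : finType) (m : nat) (I : S -> set R).
Hypothesis open_I : forall s, open (I s).

Definition base (p : S + 'I_m -> R) : S -> R := fun s => p (inl s).

Lemma base_move_inl s p t : base (move (inl s) p t) = move s (base p) t.
Proof. by apply/funext => u; rewrite /base !moveE. Qed.

Lemma base_move_inr a p t : base (move (inr a) p t) = base p.
Proof. by apply/funext => u; rewrite /base !moveE. Qed.

Definition pderiv_base (c : S + 'I_m) (F : (S -> R) -> R) (x : S -> R) : R :=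
  if c is inl s then pderiv s F x else 0.

(** A move in an angular coordinate fixes the base point, so [f] is constant along that whole
    line. *)
Lemma pderiv_baseE c f F p : (forall q, box I (base q) -> f q = F (base q)) ->
  box I (base p) -> pderiv c f p = pderiv_base c F (base p).
Proof.
move=> fF bp; case: c => [s|a] /=.
  rewrite !pderivE; apply: near_eq_derive.
  apply: filterS (near_box open_I s bp) => t bt.
  by rewrite fF ?base_move_inl.
rewrite pderivE (_ : (fun t => _) = cst (F (base p))); first exact: derive_cst.
by apply/funext => t; rewrite fF ?base_move_inr.
Qed.

End TorusInvariant.

(** * Curvature of diag(b) + H dt dt with coefficients depending on x only *)

Section BlockMetric.
Variables (R : realType) (S : finType) (m : nat) (I : S -> set R).
Hypothesis open_I : forall s, open (I s).
Variable g : field2 R (S + 'I_m)%type.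
Variables (b : S -> (S -> R) -> R) (H Hi : 'I_m -> 'I_m -> (S -> R) -> R).
Hypothesis b0 : forall s x, box I x -> b s x != 0.
Hypothesis smooth_b : forall s, psmooth I (b s).
Hypothesis smooth_H : forall i j, psmooth I (H i j).
Hypothesis smooth_Hi : forall i j, psmooth I (Hi i j).
Hypothesis symH : forall i j, H i j = H j i.
Hypothesis symHi : forall i j, Hi i j = Hi j i.
Hypothesis HHi : forall i j x, box I x -> \sum_l H i l x * Hi l j x = (i == j)%:R.

Definition block_metric (c e : S + 'I_m) (x : S -> R) : R :=
  match c, e with
  | inl s, inl u => (s == u)%:R * b s x
  | inr i, inr j => H i j x
  | _, _ => 0
  end.

Hypothesis gE : forall p, box I (base p) -> forall c e, g p c e = block_metric c e (base p).

Definition block_inverse (c e : S + 'I_m) (x : S -> R) : R :=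
  match c, e with
  | inl s, inl u => (s == u)%:R * (b s x)^-1
  | inr i, inr j => Hi i j x
  | _, _ => 0
  end.

(** The formula of [christoffel] carried out on functions of [x] alone, where angular derivatives
    are 0 by definition; likewise [block_ricci] for [ricci]. *)
Definition block_christoffel (c a e : S + 'I_m) (x : S -> R) : R :=
  2^-1 * \sum_l block_inverse c l x *
    (pderiv_base a (block_metric e l) x + pderiv_base e (block_metric a l) x
     - pderiv_base l (block_metric a e) x).

Definition block_ricci (c e : S + 'I_m) (x : S -> R) : R :=
  \sum_a (pderiv_base a (block_christoffel a e c) x
          - pderiv_base e (block_christoffel a a c) x
    + \sum_l (block_christoffel a a l x * block_christoffel l e c x
              - block_christoffel a e l x * block_christoffel l a c x)).

Lemma inv_block_metric p c e : box I (base p) ->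
  inv_metric g p c e = block_inverse c e (base p).
Proof.
move=> bp; apply: (@inv_metric_eq _ _ g (fun c e => block_inverse c e (base p))) => {c e} c e.
rewrite big_sumType /=; case: c => [s|i]; case: e => [u|j].
- rewrite (bigD1 s) //= !gE //= eqxx mul1r !big1 ?addr0 => [|? _|v vs].
  + rewrite mulrCA divff ?mulr1 //; exact: b0.
  + by rewrite mulr0.
  + by rewrite gE //= eq_sym (negbTE vs) !mul0r.
- rewrite !big1 ?addr0 // => [v _|v _]; last by rewrite mulr0.
  by rewrite gE ?mul0r.
- rewrite !big1 ?addr0 // => [v _|v _]; first by rewrite mulr0.
  by rewrite gE ?mul0r.
rewrite big1 ?add0r => [|v _]; last by rewrite mulr0.
by under eq_bigr do rewrite gE //=; rewrite HHi.
Qed.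

Lemma christoffel_block p c a e : box I (base p) ->
  christoffel g c a e p = block_christoffel c a e (base p).
Proof.
move=> bp; congr (_ * _); apply: eq_bigr => l _; rewrite inv_block_metric //.
by congr (_ * (_ + _ - _)); apply: (pderiv_baseE open_I) => // q bq; exact: gE.
Qed.

(** The inverse metric is block diagonal, and diagonal on the base, so the mixed components of Ricci
    drop out of the trace. *)
Lemma scal_block p : box I (base p) -> scal g p
  = \sum_s (b s (base p))^-1 * block_ricci (inl s) (inl s) (base p)
    + \sum_i \sum_j Hi i j (base p) * block_ricci (inr i) (inr j) (base p).
Proof.
move=> bp; have ric c e : ricci g c e p = block_ricci c e (base p).
  apply: eq_bigr => a _; congr (_ - _ + _).
  - by apply: (pderiv_baseE open_I) => // q bq; exact: christoffel_block.
  - by apply: (pderiv_baseE open_I) => // q bq; exact: christoffel_block.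
  - by apply: eq_bigr => l _; rewrite !christoffel_block.
rewrite /scal big_sumType /=; congr (_ + _); apply: eq_bigr => s _.
  rewrite big_sumType /= (bigD1 s) //= !big1 ?addr0 => [|v _|v vs].
  - by rewrite ric inv_block_metric //= eqxx mul1r.
  - by rewrite inv_block_metric //= mul0r.
  - by rewrite inv_block_metric //= eq_sym (negbTE vs) !mul0r.
rewrite big_sumType /= big1 ?add0r => [|v _]; last by rewrite inv_block_metric //= mul0r.
by apply: eq_bigr => j _; rewrite ric inv_block_metric.
Qed.

(** The matrix [H^-1 d_s H]; up to the factor - 1/2 it is the shape operator of the torus orbits in
    direction [x_s]. *)
Definition fiber_endo s (i j : 'I_m) (x : S -> R) : R :=
  \sum_l Hi i l x * pderiv s (H l j) x.

(** The logarithmic [x_s]-derivative of [det H]. *)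
Definition fiber_trace s (x : S -> R) : R := \sum_i \sum_j Hi i j x * pderiv s (H i j) x.

Definition fiber_trace2 s (x : S -> R) : R :=
  \sum_i \sum_j fiber_endo s i j x * fiber_endo s j i x.

(** The Christoffel symbols of the diagonal metric [\sum_s b_s dx_s^2] on the base alone. *)
Definition base_christoffel u s v (x : S -> R) : R :=
  2^-1 * (b u x)^-1 * ((v == u)%:R * pderiv s (b v) x + (s == u)%:R * pderiv v (b s) x
                       - (s == v)%:R * pderiv u (b s) x).

(** The logarithmic [x_s]-derivative of [sqrt (det g)], that is, the contracted Christoffel
    symbol. *)
Definition vol_log s (x : S -> R) : R :=
  2^-1 * (\sum_u pderiv s (b u) x / b u x + fiber_trace s x).

Lemma block_christoffel_inl u c e x : block_christoffel (inl u) c e x =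
  2^-1 * (b u x)^-1 * (pderiv_base c (block_metric e (inl u)) x
     + pderiv_base e (block_metric c (inl u)) x - pderiv u (block_metric c e) x).
Proof.
rewrite /block_christoffel -mulrA; congr (_ * _).
rewrite big_sumType /= (bigD1 u) //= eqxx mul1r !big1 ?addr0 // => v; first by rewrite mul0r.
by rewrite eq_sym => /negbTE ->; rewrite !mul0r.
Qed.

Lemma block_christoffel_inr i c e x : block_christoffel (inr i) c e x =
  2^-1 * \sum_j Hi i j x * (pderiv_base c (block_metric e (inr j)) x
     + pderiv_base e (block_metric c (inr j)) x).
Proof.
rewrite /block_christoffel; congr (_ * _).
rewrite big_sumType /= big1 ?add0r => [|v _]; last by rewrite mul0r.
by apply: eq_bigr => j _; rewrite subr0.
Qed.

Lemma christoffel_bbb u s v x : box I x ->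
  block_christoffel (inl u) (inl s) (inl v) x = base_christoffel u s v x.
Proof.
move=> bx; rewrite block_christoffel_inl /= /base_christoffel.
by congr (_ * (_ + _ - _)); rewrite pderivZ //; exact: psmooth_pderivable.
Qed.

(** Symbols with an odd number of angular indices vanish because t -> - t is an isometry; the same
    reason stands behind [christoffel_bbf], [christoffel_fbb] and [christoffel_fff]. *)
Lemma christoffel_bfb u i s x : block_christoffel (inl u) (inr i) (inl s) x = 0.
Proof. by rewrite block_christoffel_inl /= !pderiv_cst add0r subr0 mulr0. Qed.

Lemma christoffel_bbf u i s x : block_christoffel (inl u) (inl s) (inr i) x = 0.
Proof. by rewrite block_christoffel_inl /= !pderiv_cst add0r subr0 mulr0. Qed.

Lemma christoffel_bff u i j x :
  block_christoffel (inl u) (inr i) (inr j) x = - 2^-1 * ((b u x)^-1 * pderiv u (H i j) x).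
Proof.
by rewrite block_christoffel_inl /= add0r sub0r mulrN -mulrA mulNr.
Qed.

Lemma christoffel_fbb i s u x : block_christoffel (inr i) (inl s) (inl u) x = 0.
Proof.
rewrite block_christoffel_inr /= big1 ?mulr0 // => j _.
by rewrite !pderiv_cst addr0 mulr0.
Qed.

Lemma christoffel_fff i j l x : block_christoffel (inr i) (inr j) (inr l) x = 0.
Proof.
by rewrite block_christoffel_inr /= big1 ?mulr0 // => k _; rewrite addr0 mulr0.
Qed.

Lemma christoffel_fbf i s j x :
  block_christoffel (inr i) (inl s) (inr j) x = 2^-1 * fiber_endo s i j x.
Proof.
rewrite block_christoffel_inr /=; congr (_ * _); apply: eq_bigr => l _.
by rewrite addr0 symH.
Qed.

Lemma christoffel_ffb i s j x :
  block_christoffel (inr i) (inr j) (inl s) x = 2^-1 * fiber_endo s i j x.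
Proof.
rewrite block_christoffel_inr /=; congr (_ * _); apply: eq_bigr => l _.
by rewrite add0r symH.
Qed.

Lemma base_christoffel_trace u s x : base_christoffel u u s x = 2^-1 * (pderiv s (b u) x / b u x).
Proof.
rewrite /base_christoffel eqxx mul1r eq_sym.
have [->|us] := eqVneq u s; first by rewrite !mul1r addrK -mulrA [_^-1 * pderiv _ _ _]mulrC.
by rewrite !mul0r add0r subr0 -mulrA [_^-1 * pderiv _ _ _]mulrC.
Qed.

Lemma fiber_traceE s x : \sum_i fiber_endo s i i x = fiber_trace s x.
Proof.
by apply: eq_bigr => i _; apply: eq_bigr => l _; rewrite symH.
Qed.

Lemma trace_christoffel_inl s x : box I x ->
  \sum_a block_christoffel a a (inl s) x = vol_log s x.
Proof.
move=> bx; rewrite big_sumType /= /vol_log mulrDr !mulr_sumr; congr (_ + _).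
  by apply: eq_bigr => u _; rewrite christoffel_bbb // base_christoffel_trace.
under eq_bigr do rewrite christoffel_ffb.
by rewrite -!mulr_sumr fiber_traceE.
Qed.

Lemma trace_christoffel_inr i x : \sum_a block_christoffel a a (inr i) x = 0.
Proof.
rewrite big_sumType /= !big1 ?addr0 // => a _; first exact: christoffel_fff.
exact: christoffel_bbf.
Qed.

(** Separates the contracted symbols, which are known in closed form, from the one term that is
    quadratic in uncontracted symbols. *)
Lemma block_ricciE c e x : block_ricci c e x =
  \sum_a pderiv_base a (block_christoffel a e c) x
  - \sum_a pderiv_base e (block_christoffel a a c) x
  + \sum_l (\sum_a block_christoffel a a l x) * block_christoffel l e c x
  - \sum_a \sum_l block_christoffel a e l x * block_christoffel l a c x.
Proof.
rewrite /block_ricci big_split sumrB -addrA; congr (_ + _).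
under eq_bigr do rewrite sumrB.
rewrite sumrB exchange_big /=; congr (_ - _).
by apply: eq_bigr => l _; rewrite mulr_suml.
Qed.

Lemma ricci_fiber i j x : box I x -> block_ricci (inr i) (inr j) x =
  \sum_s (- 2^-1) * (pderiv s (fun y => (b s y)^-1 * pderiv s (H i j) y) x
    + vol_log s x * ((b s x)^-1 * pderiv s (H i j) x)
    - (b s x)^-1 * \sum_l pderiv s (H j l) x * fiber_endo s l i x).
Proof.
move=> bx; rewrite block_ricciE.
rewrite [X in _ - X + _]big1 // subr0 !big_sumType /=.
rewrite [X in (_ + X) + _ - _]big1 // addr0.
rewrite [X in _ + (_ + X) - _]big1 ?addr0 => [|l _]; last first.
  by rewrite trace_christoffel_inr mul0r.
(* In the quadratic term one contracted index is a base index and the other an angular one; the two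
   possibilities, treated in turn, contribute equally. *)
have -> : \sum_s \sum_l block_christoffel (inl s) (inr j) l x * block_christoffel l (inl s) (inr i) x
  = - 2^-1 * (\sum_s (b s x)^-1 * \sum_l pderiv s (H j l) x * fiber_endo s l i x) / 2.
  rewrite -mulrA mulr_suml mulr_sumr; apply: eq_bigr => s _.
  rewrite big_sumType /= big1 ?add0r => [|u _]; last by rewrite christoffel_bfb mul0r.
  rewrite mulr_sumr mulr_suml mulr_sumr; apply: eq_bigr => l _.
  by rewrite christoffel_bff christoffel_fbf; ring.
have -> : \sum_l \sum_a block_christoffel (inr l) (inr j) a x * block_christoffel a (inr l) (inr i) x
  = - 2^-1 * (\sum_s (b s x)^-1 * \sum_l pderiv s (H j l) x * fiber_endo s l i x) / 2.
  rewrite -mulrA mulr_suml mulr_sumr.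
  under eq_bigr => l _.
    rewrite big_sumType /= [X in _ + X]big1 ?addr0 => [|u _]; last by rewrite christoffel_fff mul0r.
    over.
  rewrite exchange_big /=; apply: eq_bigr => s _.
  (* The matrix [d_s H . H^-1 . d_s H] is symmetric. *)
  have -> : \sum_l pderiv s (H j l) x * fiber_endo s l i x
            = \sum_l pderiv s (H i l) x * fiber_endo s l j x.
    rewrite /fiber_endo.
    under [RHS]eq_bigr do rewrite mulr_sumr.
    rewrite [RHS]exchange_big /=; apply: eq_bigr => k _; rewrite mulr_sumr.
    by apply: eq_bigr => l _; rewrite (symHi l k) (symH l i) (symH j k); ring.
  rewrite mulr_sumr mulr_suml mulr_sumr; apply: eq_bigr => l _.
  by rewrite christoffel_bff christoffel_ffb (symH l i); ring.
rewrite -mulr_sumr big_split /= big_split /= sumrN.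
have -> : \sum_s pderiv s (block_christoffel (inl s) (inr j) (inr i)) x
   = - 2^-1 * \sum_s pderiv s (fun y => (b s y)^-1 * pderiv s (H i j) y) x.
  rewrite mulr_sumr; apply: eq_bigr => s _; rewrite -pderivZ; last first.
    apply: (psmooth_pderivable s _ bx); apply: (psmoothM open_I); last exact: psmooth_pderiv.
    by apply: (psmoothV open_I) => // y By; exact: b0.
  congr (pderiv s _ x); apply/funext => y; rewrite christoffel_bff.
  by rewrite (symH j i).
have -> : \sum_s (\sum_a block_christoffel a a (inl s) x) * block_christoffel (inl s) (inr j) (inr i) x
   = - 2^-1 * \sum_s vol_log s x * ((b s x)^-1 * pderiv s (H i j) x).
  rewrite mulr_sumr; apply: eq_bigr => s _; rewrite trace_christoffel_inl // christoffel_bff.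
  by rewrite (symH j i); ring.
by field.
Qed.

Lemma psmooth_fiber_endo s i j : psmooth I (fiber_endo s i j).
Proof.
by apply: (psmooth_sum open_I) => l _; apply: (psmoothM open_I) => //; exact: psmooth_pderiv.
Qed.

(** Differentiate [Hi H = 1] and multiply by [Hi] on the right. *)
Lemma pderiv_fiber_inverse s i j x : box I x ->
  pderiv s (Hi i j) x = - \sum_k \sum_l Hi i k x * pderiv s (H k l) x * Hi l j x.
Proof.
move=> bx.
have D k : \sum_l (pderiv s (Hi i l) x * H l k x + Hi i l x * pderiv s (H l k) x) = 0.
  transitivity (pderiv s (fun y => \sum_l Hi i l y * H l k y) x).
    rewrite pderiv_sum => [|l _].
      by apply: eq_bigr => l _; rewrite pderivM //; exact: psmooth_pderivable.
    by apply: pderivableM; exact: psmooth_pderivable.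
  rewrite -[RHS](pderiv_cst s (k == i)%:R x); apply: (pderiv_eq_box open_I _ _ bx) => y By.
  rewrite -(HHi _ _ By); apply: eq_bigr => l _.
  by rewrite mulrC (symH l k) (symHi i l).
have E k : \sum_l pderiv s (Hi i l) x * H l k x = - \sum_l Hi i l x * pderiv s (H l k) x.
  by apply/eqP; rewrite -subr_eq0 opprK -big_split D.
transitivity (\sum_k (\sum_l pderiv s (Hi i l) x * H l k x) * Hi k j x).
  under eq_bigr do rewrite mulr_suml.
  rewrite exchange_big (bigD1 j) //= [X in _ + X]big1 ?addr0 => [|l lj].
    under eq_bigr do rewrite -mulrA.
    by rewrite -mulr_sumr HHi // eqxx mulr1.
  under eq_bigr do rewrite -mulrA.
  by rewrite -mulr_sumr HHi // (negbTE lj) mulr0.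
under eq_bigr do rewrite E mulNr mulr_suml.
by rewrite sumrN exchange_big.
Qed.

(** Pulling [Hi] under the derivative costs the trace of [d_s (H^-1) d_s H], which is minus that of
    [(H^-1 d_s H)^2]; this is precisely the quadratic term of [ricci_fiber], so the trace becomes a
    divergence. *)
Lemma trace_ricci_fiber x : box I x ->
  \sum_i \sum_j Hi i j x * block_ricci (inr i) (inr j) x =
  \sum_s (- 2^-1) * (pderiv s (fun y => (b s y)^-1 * fiber_trace s y) x
                     + vol_log s x * ((b s x)^-1 * fiber_trace s x)).
Proof.
move=> bx.
under eq_bigr do under eq_bigr do rewrite ricci_fiber // mulr_sumr.
under eq_bigr do rewrite exchange_big.
rewrite exchange_big; apply: eq_bigr => s _ /=.
have sbV : psmooth I (fun y => (b s y)^-1) by apply: (psmoothV open_I) => // y By; exact: b0.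
have sHi i j : psmooth I (fun y => (b s y)^-1 * pderiv s (H i j) y).
  by apply: (psmoothM open_I) => //; exact: psmooth_pderiv.
have -> : pderiv s (fun y => (b s y)^-1 * fiber_trace s y) x =
  \sum_i \sum_j (Hi i j x * pderiv s (fun y => (b s y)^-1 * pderiv s (H i j) y) x
     + pderiv s (Hi i j) x * ((b s x)^-1 * pderiv s (H i j) x)).
  rewrite (_ : (fun y => _) = fun y => \sum_i \sum_j Hi i j y * ((b s y)^-1 * pderiv s (H i j) y)).
    rewrite pderiv_sum => [|i _]; last first.
      apply: pderivable_sum => j _.
      by apply: (psmooth_pderivable s _ bx); exact: (psmoothM open_I).
    apply: eq_bigr => i _; rewrite pderiv_sum => [|j _].
      apply: eq_bigr => j _; rewrite pderivM 1?addrC //; exact: psmooth_pderivable bx.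
    by apply: (psmooth_pderivable s _ bx); exact: (psmoothM open_I).
  apply/funext => y; rewrite mulr_sumr; apply: eq_bigr => i _.
  by rewrite mulr_sumr; apply: eq_bigr => j _; rewrite mulrCA.
have T2 : \sum_i \sum_j pderiv s (Hi i j) x * ((b s x)^-1 * pderiv s (H i j) x)
   = - \sum_i \sum_j Hi i j x * ((b s x)^-1 * \sum_l pderiv s (H j l) x * fiber_endo s l i x).
  rewrite -sumrN.
  transitivity (- ((b s x)^-1 * fiber_trace2 s x)); last first.
    rewrite sumrN; congr (- _); rewrite mulr_sumr; apply: eq_bigr => i _.
    rewrite /fiber_endo mulr_sumr.
    under eq_bigr do rewrite mulr_suml mulr_sumr.
    rewrite exchange_big; apply: eq_bigr => j _ /=.
    by rewrite !mulr_sumr; apply: eq_bigr => l _; ring.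
  rewrite mulr_sumr -sumrN; apply: eq_bigr => i _; rewrite mulr_sumr -sumrN.
  transitivity (\sum_j \sum_l - ((b s x)^-1 * (fiber_endo s i l x * (Hi l j x * pderiv s (H j i) x)))).
    apply: eq_bigr => j _; rewrite pderiv_fiber_inverse // exchange_big mulNr mulr_suml sumrN.
    congr (- _); apply: eq_bigr => l _; rewrite -mulr_suml -/(fiber_endo s i l x).
    by rewrite (symH i j); ring.
  rewrite exchange_big; apply: eq_bigr => l _ /=; rewrite sumrN; congr (- _).
  by rewrite -!mulr_sumr.
rewrite [X in _ * (X + _)](_ : _ = \sum_i \sum_j Hi i j x * pderiv s (fun y => (b s y)^-1 * pderiv s (H i j) y) x
  + \sum_i \sum_j pderiv s (Hi i j) x * ((b s x)^-1 * pderiv s (H i j) x)); last first.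
  by rewrite -big_split; apply: eq_bigr => i _; rewrite -big_split.
rewrite T2 -!sumrN /fiber_trace !mulr_sumr -!big_split mulr_sumr.
apply: eq_bigr => i _; rewrite -sumrN !mulr_sumr -!big_split mulr_sumr /=.
by apply: eq_bigr => j _; ring.
Qed.

(** The Ricci expression of the base metric, with the volume of the total space in place of that of
    the base; otherwise the torus enters only through the quadratic term [fiber_trace2]. *)
Lemma ricci_base s x : box I x -> block_ricci (inl s) (inl s) x =
  \sum_u pderiv u (base_christoffel u s s) x - pderiv s (vol_log s) x
  + \sum_u vol_log u x * base_christoffel u s s x
  - \sum_u \sum_v base_christoffel u s v x * base_christoffel v u s x
  - 4^-1 * fiber_trace2 s x.
Proof.
move=> bx; rewrite block_ricciE.
have sbV u : psmooth I (fun y => (b u y)^-1) by apply: (psmoothV open_I) => // y By; exact: b0.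
rewrite -!addrA; congr (_ + _).
  rewrite big_sumType /= [X in _ + X]big1 // addr0.
  by apply: eq_bigr => u _; apply: (pderiv_eq_box open_I _ _ bx) => y By; exact: christoffel_bbb.
congr (_ + _).
  rewrite -pderiv_sum => [|a _]; last first.
    case: a => [u|i].
      apply: (@pderivable_eq_box _ _ I open_I _ (fun y => 2^-1 * (pderiv s (b u) y / b u y))) => //.
        by move=> y By; rewrite christoffel_bbb // base_christoffel_trace.
      apply: (psmooth_pderivable s _ bx); apply: (psmoothM open_I); first exact: psmooth_cst.
      by apply: (psmoothM open_I) => //; exact: psmooth_pderiv.
    rewrite (_ : block_christoffel _ _ _ = fun y => 2^-1 * fiber_endo s i i y).
      apply: (psmooth_pderivable s _ bx); apply: (psmoothM open_I); first exact: psmooth_cst.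
      exact: psmooth_fiber_endo.
    by apply/funext => y; exact: christoffel_ffb.
  by congr (- _); apply: (pderiv_eq_box open_I _ _ bx) => y By; exact: trace_christoffel_inl.
congr (_ + _).
  rewrite big_sumType /= [X in _ + X]big1 ?addr0 => [|i _]; last first.
    by rewrite trace_christoffel_inr mul0r.
  by apply: eq_bigr => u _; rewrite trace_christoffel_inl // christoffel_bbb.
rewrite -opprD; congr (- _); rewrite big_sumType /=; congr (_ + _).
  apply: eq_bigr => u _; rewrite big_sumType /= [X in _ + X]big1 ?addr0 => [|i _].
    by apply: eq_bigr => v _; rewrite !christoffel_bbb.
  by rewrite christoffel_bbf mul0r.
rewrite mulr_sumr; apply: eq_bigr => i _; rewrite big_sumType /= big1 ?add0r => [|u _].
  rewrite mulr_sumr; apply: eq_bigr => j _; rewrite christoffel_fbf christoffel_ffb.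
  by field.
by rewrite christoffel_fbb mul0r.
Qed.

End BlockMetric.

(** * Scalar curvature when H comes from a frame P with the derivative identities above *)

Section FrameMetric.
Variables (R : realType) (S : finType) (m : nat) (I : S -> set R).
Hypothesis open_I : forall s, open (I s).
Variable g : field2 R (S + 'I_m)%type.
Variables (b : S -> (S -> R) -> R) (P : S -> 'I_m -> (S -> R) -> R)
  (Q : 'I_m -> S -> (S -> R) -> R) (kap : S -> (S -> R) -> R).
Hypothesis b0 : forall s x, box I x -> b s x != 0.
Hypothesis smooth_b : forall s, psmooth I (b s).
Hypothesis smooth_P : forall s i, psmooth I (P s i).
Hypothesis smooth_Q : forall i s, psmooth I (Q i s).
Hypothesis smooth_kap : forall s, psmooth I (kap s).
Hypothesis PQ : forall s u x, box I x -> \sum_i P s i x * Q i u x = (s == u)%:R.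
Hypothesis QP : forall i j x, box I x -> \sum_s Q i s x * P s j x = (i == j)%:R.

Definition dlog s u (x : S -> R) : R := pderiv s (b u) x / b u x.

Hypothesis dP_off : forall s u i x, u != s -> box I x ->
  pderiv s (P u i) x = dlog s u x * P u i x + dlog u s x * P s i x.
Hypothesis dP_diag : forall s i x, box I x -> pderiv s (P s i) x = kap s x * P s i x.
Hypothesis ddb : forall s u x, u != s -> box I x ->
  pderiv s (pderiv s (b u)) x = kap s x * pderiv s (b u) x.
Hypothesis dkap : forall s x, box I x -> pderiv s (kap s) x = kap s x ^+ 2 / 2.

Definition frame_gram i j (x : S -> R) : R := \sum_s (b s x)^-1 * (P s i x * P s j x).
Definition frame_cogram i j (x : S -> R) : R := \sum_s b s x * (Q i s x * Q j s x).

Hypothesis gE : forall p, box I (base p) -> forall c e,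
  g p c e = block_metric b frame_gram c e (base p).

(** [lam] and [tau] are the closed forms of [vol_log] and [fiber_trace], as shown in [vol_log_frame]
    and [fiber_trace_frame]. *)
Definition lam s (x : S -> R) : R := kap s x + \sum_(u | u != s) dlog s u x.
Definition tau s (x : S -> R) : R := lam s x + kap s x - dlog s s x.

(** [P Q = 1] removes the frame from a contraction over the angular index, leaving a sum over
    slots. *)
Lemma frame_contract (v w : S -> R) x : box I x ->
  \sum_i (\sum_u v u * P u i x) * (\sum_s w s * Q i s x) = \sum_u v u * w u.
Proof.
move=> bx.
under eq_bigr do rewrite mulr_suml.
rewrite exchange_big; apply: eq_bigr => u _ /=.
under eq_bigr do rewrite mulr_sumr.
rewrite exchange_big /=.
transitivity (\sum_s v u * w s * \sum_i P u i x * Q i s x).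
  by apply: eq_bigr => s _; rewrite mulr_sumr; apply: eq_bigr => i _; ring.
rewrite (bigD1 u) //= [X in _ + X]big1 ?addr0 => [|s su]; first by rewrite PQ // eqxx mulr1.
by rewrite PQ // eq_sym (negbTE su) mulr0.
Qed.

Lemma frame_gram_sym i j : frame_gram i j = frame_gram j i.
Proof. by apply/funext => x; apply: eq_bigr => s _; rewrite [P s i x * _]mulrC. Qed.

Lemma frame_cogram_sym i j : frame_cogram i j = frame_cogram j i.
Proof. by apply/funext => x; apply: eq_bigr => s _; rewrite [Q i s x * _]mulrC. Qed.

(** [(P^T diag(1/b) P) (Q diag(b) Q^T)] collapses by [P Q = 1] to [(Q P)^T], which is 1 as well. *)
Lemma frame_gramK i j x : box I x ->
  \sum_l frame_gram i l x * frame_cogram l j x = (i == j)%:R.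
Proof.
move=> bx; rewrite eq_sym -(QP j i bx).
transitivity (\sum_l (\sum_u ((b u x)^-1 * P u i x) * P u l x) * (\sum_s (b s x * Q j s x) * Q l s x)).
  apply: eq_bigr => l _; congr (_ * _); apply: eq_bigr => u _; ring.
rewrite frame_contract //; apply: eq_bigr => u _.
by field; exact: b0.
Qed.

Lemma smooth_bV s : psmooth I (fun x => (b s x)^-1).
Proof. by apply: (psmoothV open_I) => // y By; exact: b0. Qed.

Lemma smooth_dlog s u : psmooth I (dlog s u).
Proof. by apply: (psmoothM open_I); [exact: psmooth_pderiv|exact: smooth_bV]. Qed.

Lemma smooth_lam s : psmooth I (lam s).
Proof.
apply: (psmoothD open_I) => //; apply: (psmooth_sum open_I) => u _; exact: smooth_dlog.
Qed.

Lemma smooth_tau s : psmooth I (tau s).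
Proof.
apply: (psmoothD open_I); last by apply: (psmoothN open_I); exact: smooth_dlog.
by apply: (psmoothD open_I) => //; exact: smooth_lam.
Qed.

Lemma smooth_frame_gram i j : psmooth I (frame_gram i j).
Proof.
apply: (psmooth_sum open_I) => s _; apply: (psmoothM open_I); first exact: smooth_bV.
exact: (psmoothM open_I).
Qed.

Lemma smooth_frame_cogram i j : psmooth I (frame_cogram i j).
Proof.
apply: (psmooth_sum open_I) => s _; apply: (psmoothM open_I) => //.
exact: (psmoothM open_I).
Qed.

(* The matrix T such that the s-derivative of frame_gram is P^T T P. *)
Definition gram_deriv s u v (x : S -> R) : R :=
  if u == v then
    (b u x)^-1 * (if u == s then 2 * kap s x - dlog s s x else dlog s u x)
  else if u == s then (b v x)^-1 * dlog v s x
  else if v == s then (b u x)^-1 * dlog u s x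
  else 0.

Lemma pderiv_bV s u x : box I x ->
  pderiv s (fun y => (b u y)^-1) x = - (b u x)^-1 * dlog s u x.
Proof.
move=> bx; rewrite pderivV ?b0 //; last exact: psmooth_pderivable.
by rewrite /dlog; field; exact: b0.
Qed.

(** Differentiating [P_u] along [x_s] yields multiples of [P_u] and [P_s] only, so the matrix [T]
    lives on the diagonal and in row and column [s]. *)
Lemma pderiv_frame_gram s i j x : box I x -> pderiv s (frame_gram i j) x =
  \sum_u (\sum_v gram_deriv s u v x * P v j x) * P u i x.
Proof.
move=> bx; rewrite pderiv_sum => [|u _]; last first.
  apply: (psmooth_pderivable s _ bx); apply: (psmoothM open_I); first exact: smooth_bV.
  exact: (psmoothM open_I).
have D u : pderiv s (fun y => (b u y)^-1 * (P u i y * P u j y)) x =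
  - (b u x)^-1 * dlog s u x * (P u i x * P u j x)
  + (b u x)^-1 * (pderiv s (P u i) x * P u j x + P u i x * pderiv s (P u j) x).
  rewrite pderivM ?pderiv_bV ?pderivM //; try exact: (psmooth_pderivable s _ bx).
    exact: (psmooth_pderivable s (smooth_bV u) bx).
  by apply: (psmooth_pderivable s _ bx); exact: (psmoothM open_I).
under eq_bigr do rewrite D.
rewrite (bigD1 s) //= [RHS](bigD1 s) //= !dP_diag // [X in _ = X * _ + _](bigD1 s) //=.
rewrite [X in _ = X + _]mulrDl -[RHS]addrA; congr (_ + _); first by rewrite /gram_deriv !eqxx; ring.
rewrite mulr_suml -big_split; apply: eq_bigr => u us /=.
rewrite (bigD1 s) //= (bigD1 u) //= [X in _ + (_ + X)]big1 ?addr0 => [|v /andP[vs vu]]; last first.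
  by rewrite /gram_deriv ?[u == v]eq_sym ?(negbTE vu) ?(negbTE us) ?(negbTE vs) mul0r.
rewrite !dP_off // /gram_deriv !eqxx ?[s == u]eq_sym ?(negbTE us).
by ring.
Qed.

(** [H^-1 d_s H = Q (diag(b) T) P] is conjugate to [diag(b) T]; traces of its powers can therefore
    be computed from [T]. *)
Lemma fiber_endo_frame s i j x : box I x -> fiber_endo frame_gram frame_cogram s i j x =
  \sum_u (b u x * \sum_v gram_deriv s u v x * P v j x) * Q i u x.
Proof.
move=> bx.
transitivity (\sum_l (\sum_u (\sum_v gram_deriv s u v x * P v j x) * P u l x)
    * (\sum_u (b u x * Q i u x) * Q l u x)).
  apply: eq_bigr => l _; rewrite pderiv_frame_gram // mulrC; congr (_ * _).
  by apply: eq_bigr => u _; ring.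
by rewrite frame_contract //; apply: eq_bigr => u _; ring.
Qed.

Lemma fiber_trace_frame s x : box I x ->
  fiber_trace frame_gram frame_cogram s x = tau s x.
Proof.
move=> bx; rewrite -fiber_traceE; last exact: frame_gram_sym.
under eq_bigr do rewrite fiber_endo_frame //.
transitivity (\sum_u \sum_v b u x * gram_deriv s u v x * \sum_i P v i x * Q i u x).
  rewrite exchange_big; apply: eq_bigr => u _ /=.
  under eq_bigr do rewrite mulr_sumr mulr_suml.
  rewrite exchange_big; apply: eq_bigr => v _ /=; rewrite mulr_sumr.
  by apply: eq_bigr => i _; ring.
transitivity (\sum_u b u x * gram_deriv s u u x).
  apply: eq_bigr => u _; rewrite (bigD1 u) //= [X in _ + X]big1 ?addr0 => [|v vu].
    by rewrite PQ // eqxx mulr1.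
  by rewrite PQ // (negbTE vu) mulr0.
rewrite (bigD1 s) //= /gram_deriv !eqxx mulVKf ?b0 // /tau /lam.
rewrite (eq_bigr (fun u => dlog s u x)); first ring.
by move=> u us; rewrite eqxx (negbTE us) mulVKf // b0.
Qed.

(** The trace of the square of [diag(b) T]: diagonal squares, plus the products of the entries (s,
    u) and (u, s), each of which occurs twice. *)
Lemma fiber_trace2_frame s x : box I x ->
  fiber_trace2 frame_gram frame_cogram s x =
  (2 * kap s x - dlog s s x) ^+ 2 + \sum_(u | u != s) dlog s u x ^+ 2
  + 2 * \sum_(u | u != s) (b u x)^-1 * (dlog u s x * pderiv u (b s) x).
Proof.
move=> bx.
transitivity (\sum_u \sum_v b u x * gram_deriv s u v x * (b v x * gram_deriv s v u x)).
  rewrite /fiber_trace2.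
  under eq_bigr => i _ do under eq_bigr => j _ do rewrite !fiber_endo_frame //.
  transitivity (\sum_i \sum_u (\sum_v b u x * gram_deriv s u v x *
      (b v x * \sum_w gram_deriv s v w x * P w i x)) * Q i u x).
    apply: eq_bigr => i _.
    transitivity (\sum_j (\sum_v (\sum_u b u x * gram_deriv s u v x * Q i u x) * P v j x)
       * (\sum_v (b v x * \sum_w gram_deriv s v w x * P w i x) * Q j v x)).
      apply: eq_bigr => j _; congr (_ * _).
      under [RHS]eq_bigr do rewrite mulr_suml.
      rewrite [RHS]exchange_big; apply: eq_bigr => u _ /=.
      by rewrite mulr_sumr mulr_suml; apply: eq_bigr => v _; ring.
    rewrite frame_contract //.
    under eq_bigr do rewrite mulr_suml.
    rewrite exchange_big; apply: eq_bigr => u _ /=; rewrite mulr_suml.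
    by apply: eq_bigr => v _; ring.
  transitivity (\sum_i \sum_u \sum_w (\sum_v b u x * gram_deriv s u v x * (b v x * gram_deriv s v w x))
      * (P w i x * Q i u x)).
    apply: eq_bigr => i _; apply: eq_bigr => u _; rewrite mulr_suml.
    under [RHS]eq_bigr do rewrite mulr_suml.
    rewrite [RHS]exchange_big; apply: eq_bigr => v _ /=.
    by rewrite !mulr_sumr mulr_suml; apply: eq_bigr => w _; ring.
  rewrite exchange_big; apply: eq_bigr => u _ /=; rewrite exchange_big (bigD1 u) //=.
  rewrite -mulr_sumr PQ // eqxx mulr1 [X in _ + X]big1 ?addr0 // => w wu.
  by rewrite -mulr_sumr PQ // (negbTE wu) mulr0.
rewrite (bigD1 s) //= (bigD1 s) //= -!addrA; congr (_ + _).
  by rewrite /gram_deriv !eqxx; field; exact: b0.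
have -> : \sum_(u | u != s) \sum_v b u x * gram_deriv s u v x * (b v x * gram_deriv s v u x)
  = \sum_(u | u != s) (dlog s u x ^+ 2 + (b u x)^-1 * (dlog u s x * pderiv u (b s) x)).
  apply: eq_bigr => u us; rewrite (bigD1 s) //= (bigD1 u) //= [X in _ + (_ + X)]big1 ?addr0 => [|v /andP[vs vu]].
    rewrite /gram_deriv !eqxx ?[s == u]eq_sym ?(negbTE us) /dlog.
    by field; rewrite !b0.
  by rewrite /gram_deriv ?[u == v]eq_sym ?(negbTE vu) ?(negbTE us) ?(negbTE vs) mulr0 mul0r.
rewrite big_split /= addrCA; congr (_ + _); rewrite mulr_natl mulr2n; congr (_ + _).
apply: eq_bigr => u us; rewrite /gram_deriv !eqxx ?[s == u]eq_sym ?(negbTE us) /dlog.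
by field; rewrite !b0.
Qed.

Lemma vol_log_frame s x : box I x -> vol_log b frame_gram frame_cogram s x = lam s x.
Proof.
move=> bx; rewrite /vol_log fiber_trace_frame // /tau /lam (bigD1 s) //=.
by rewrite -/(dlog s s x); field.
Qed.

(** [ddb] and [dkap] eliminate every second derivative except [pderiv s (dlog s s)]. The last sum
    collects the terms with a derivative of [b s] in a foreign direction [u]; they are rearranged
    only after summation over [s]. *)
Lemma ricci_base_frame s x : box I x ->
  block_ricci b frame_gram frame_cogram (inl s) (inl s) x =
  2^-1 * pderiv s (dlog s s) x
  - (kap s x ^+ 2 / 2 + \sum_(u | u != s) (kap s x * dlog s u x - dlog s u x ^+ 2))
  + 2^-1 * (lam s x * dlog s s x) - 2^-1 * \sum_(u | u != s) dlog s u x ^+ 2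
  - 4^-1 * dlog s s x ^+ 2 - 4^-1 * (2 * kap s x - dlog s s x) ^+ 2
  - 2^-1 * \sum_(u | u != s) (b u x)^-1 * ((kap u x - dlog u u x + lam u x) * pderiv u (b s) x).
Proof.
move=> bx; rewrite (ricci_base open_I) //; try by
  [exact: smooth_frame_gram|exact: smooth_frame_cogram|exact: frame_gram_sym].
have off u y : u != s -> base_christoffel b u s s y = - 2^-1 * ((b u y)^-1 * pderiv u (b s) y).
  by rewrite /base_christoffel eqxx eq_sym => /negbTE -> /=; ring.
have diag y : base_christoffel b s s s y = 2^-1 * dlog s s y.
  by rewrite /base_christoffel eqxx /dlog /=; ring.
have -> : pderiv s (vol_log b frame_gram frame_cogram s) x =
   kap s x ^+ 2 / 2 + \sum_(u | u != s) (kap s x * dlog s u x - dlog s u x ^+ 2).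
  rewrite (@pderiv_eq_box _ _ I open_I s _ (lam s) x) //; last exact: vol_log_frame.
  rewrite pderivD; last 2 first.
  - exact: psmooth_pderivable.
  - by apply: (psmooth_pderivable s _ bx); apply: (psmooth_sum open_I) => u _; exact: smooth_dlog.
  rewrite dkap // pderiv_sum => [|u _]; last by apply: (psmooth_pderivable s _ bx); exact: smooth_dlog.
  congr (_ + _); apply: eq_bigr => u us.
  rewrite pderivM; last 2 first.
  - by apply: (psmooth_pderivable s _ bx); exact: psmooth_pderiv.
  - exact: (psmooth_pderivable s (smooth_bV u) bx).
  by rewrite ddb // pderiv_bV // /dlog; field; exact: b0.
have -> : \sum_u pderiv u (base_christoffel b u s s) x = 2^-1 * pderiv s (dlog s s) x
   - 2^-1 * \sum_(u | u != s) (b u x)^-1 * ((kap u x - dlog u u x) * pderiv u (b s) x).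
  rewrite (bigD1 s) //=; congr (_ + _).
    rewrite -pderivZ; first by congr (pderiv s _ x); apply/funext => y; exact: diag.
    by apply: (psmooth_pderivable s _ bx); exact: smooth_dlog.
  rewrite mulr_sumr -sumrN; apply: eq_bigr => u us.
  rewrite (_ : base_christoffel b u s s = fun y => - 2^-1 * ((b u y)^-1 * pderiv u (b s) y)); last first.
    by apply/funext => y; exact: off.
  have dbV := psmooth_pderivable u (smooth_bV u) bx.
  have ddbs : pderivable u (pderiv u (b s)) x.
    by apply: (psmooth_pderivable u _ bx); exact: psmooth_pderiv.
  rewrite pderivZ; last exact: pderivableM.
  rewrite pderivM // ddb // 1?eq_sym // pderiv_bV //.
  by ring.
have -> : \sum_u vol_log b frame_gram frame_cogram u x * base_christoffel b u s s x =
   2^-1 * (lam s x * dlog s s x)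
   - 2^-1 * \sum_(u | u != s) (b u x)^-1 * (lam u x * pderiv u (b s) x).
  rewrite (bigD1 s) //= vol_log_frame // diag; congr (_ + _); first ring.
  rewrite mulr_sumr -sumrN; apply: eq_bigr => u us.
  by rewrite vol_log_frame // off //; ring.
have -> : \sum_u \sum_v base_christoffel b u s v x * base_christoffel b v u s x
  = 4^-1 * dlog s s x ^+ 2 + 4^-1 * \sum_(u | u != s) dlog s u x ^+ 2
    - 2^-1 * \sum_(u | u != s) (b u x)^-1 * (dlog u s x * pderiv u (b s) x).
  rewrite (bigD1 s) //= (bigD1 s) //= diag -!addrA; congr (_ + _); first by field.
  have -> : \sum_(u | u != s) \sum_v base_christoffel b u s v x * base_christoffel b v u s x
     = \sum_(u | u != s) (4^-1 * dlog s u x ^+ 2 - 4^-1 * ((b u x)^-1 * (dlog u s x * pderiv u (b s) x))).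
    apply: eq_bigr => u us; rewrite (bigD1 s) //= (bigD1 u) //= [X in _ + (_ + X)]big1 ?addr0 => [|v /andP[vs vu]].
      rewrite /base_christoffel !eqxx ?[s == u]eq_sym ?(negbTE us) /dlog /=.
      by field; rewrite !b0.
    rewrite /base_christoffel (negbTE vu) [s == u]eq_sym (negbTE us) [s == v]eq_sym (negbTE vs).
    by rewrite !mul0r addr0 subr0 mulr0 mul0r.
  rewrite big_split /= addrCA mulr_sumr; congr (_ + _).
  rewrite mulr_sumr -sumrN -big_split; apply: eq_bigr => u us /=.
  rewrite /base_christoffel !eqxx ?[s == u]eq_sym ?(negbTE us) /dlog /=.
  by field; rewrite !b0.
rewrite fiber_trace2_frame //.
have -> : \sum_(u | u != s) (b u x)^-1 * ((kap u x - dlog u u x + lam u x) * pderiv u (b s) x)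
  = \sum_(u | u != s) (b u x)^-1 * ((kap u x - dlog u u x) * pderiv u (b s) x)
    + \sum_(u | u != s) (b u x)^-1 * (lam u x * pderiv u (b s) x).
  by rewrite -big_split; apply: eq_bigr => u us /=; ring.
by field.
Qed.

Lemma scal_frame p : box I (base p) -> let x := base p in
  scal g p = - \sum_s (pderiv s (fun y => (b s y)^-1 * tau s y) x
                       + lam s x * ((b s x)^-1 * tau s x)).
Proof.
move=> bp x; rewrite (scal_block open_I b0 frame_gramK gE bp) -/x.
rewrite (trace_ricci_fiber open_I b0 smooth_b smooth_frame_gram smooth_frame_cogram
  frame_gram_sym frame_cogram_sym frame_gramK bp).
(* The divergence term, expanded in the same quantities as [ricci_base_frame]. *)
have E s : pderiv s (fun y => (b s y)^-1 * tau s y) x = (b s x)^-1 *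
   (- dlog s s x * tau s x + \sum_(u | u != s) (kap s x * dlog s u x - dlog s u x ^+ 2)
    + kap s x ^+ 2 - pderiv s (dlog s s) x).
  rewrite pderivM; last 2 first.
  - exact: (psmooth_pderivable s (smooth_bV s) bp).
  - exact: (psmooth_pderivable s (smooth_tau s) bp).
  rewrite pderiv_bV // -/x.
  have dl u := psmooth_pderivable s (smooth_dlog s u) bp.
  have dk := psmooth_pderivable s (smooth_kap s) bp.
  have ds : pderivable s (fun y => \sum_(u | u != s) dlog s u y) x by exact: pderivable_sum.
  have -> : pderiv s (tau s) x = kap s x ^+ 2
     + \sum_(u | u != s) (kap s x * dlog s u x - dlog s u x ^+ 2) - pderiv s (dlog s s) x.
    rewrite pderivB //; last by apply: pderivableD => //; exact: pderivableD.
    rewrite pderivD //; last exact: pderivableD.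
    rewrite pderivD // dkap // pderiv_sum //.
    rewrite (eq_bigr (fun u => kap s x * dlog s u x - dlog s u x ^+ 2)); first by field.
    move=> u us; rewrite pderivM; last 2 first.
    - by apply: (psmooth_pderivable s _ bp); exact: psmooth_pderiv.
    - exact: (psmooth_pderivable s (smooth_bV u) bp).
    by rewrite ddb // pderiv_bV // /dlog -/x; field; exact: b0.
  by ring.
have F s : pderiv s (fun y => (b s y)^-1 * fiber_trace frame_gram frame_cogram s y) x
           = pderiv s (fun y => (b s y)^-1 * tau s y) x.
  by apply: (pderiv_eq_box open_I _ _ bp) => y By; rewrite fiber_trace_frame.
under [X in _ + X = _]eq_bigr do rewrite F vol_log_frame // fiber_trace_frame //.
under [X in X + _ = _]eq_bigr do rewrite ricci_base_frame //.
(* As [d_u b_s / b_s = dlog u s], exchanging the names of [s] and [u] turns the foreign terms into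
   multiples of [1 / b_s]. From here on the claim is an identity for each [s] separately. *)
have swap : \sum_s \sum_(u | u != s) (b s x)^-1 * ((b u x)^-1 *
      ((kap u x - dlog u u x + lam u x) * pderiv u (b s) x))
   = \sum_s (b s x)^-1 * ((kap s x - dlog s s x + lam s x) * \sum_(u | u != s) dlog s u x).
  under eq_bigr do rewrite big_mkcond.
  rewrite exchange_big; apply: eq_bigr => u _ /=.
  rewrite mulrA mulr_sumr [RHS]big_mkcond; apply: eq_bigr => s _ /=.
  by rewrite eq_sym; case: ifP => // _; rewrite /dlog; ring.
transitivity (\sum_s ((b s x)^-1 * (2^-1 * pderiv s (dlog s s) x
  - (kap s x ^+ 2 / 2 + \sum_(u | u != s) (kap s x * dlog s u x - dlog s u x ^+ 2))
  + 2^-1 * (lam s x * dlog s s x) - 2^-1 * \sum_(u | u != s) dlog s u x ^+ 2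
  - 4^-1 * dlog s s x ^+ 2 - 4^-1 * (2 * kap s x - dlog s s x) ^+ 2)
   - 2^-1 * ((b s x)^-1 * ((kap s x - dlog s s x + lam s x) * \sum_(u | u != s) dlog s u x)))
   + \sum_s - 2^-1 * (pderiv s (fun y => (b s y)^-1 * tau s y) x
                       + lam s x * ((b s x)^-1 * tau s x))).
  congr (_ + _); rewrite sumrB -mulr_sumr -swap mulr_sumr -sumrB.
  by apply: eq_bigr => s _; rewrite mulrBr -mulr_sumr; ring.
rewrite -big_split -sumrN; apply: eq_bigr => s _ /=.
rewrite E /tau /lam !sumrB -mulr_sumr.
by field; exact: b0.
Qed.

End FrameMetric.

(** * Factorization structures *)

Section TensorEvaluation.
Variables (R : realType) (S : finType) (I : S -> set R).
Hypothesis open_I : forall s, open (I s).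

Definition affine_in (s : S) (F : (S -> R) -> R) :=
  exists F0 F1, [/\ indep s F0, indep s F1 & forall x, F x = F0 x + x s * F1 x].

Lemma pderiv_affine s F : affine_in s F ->
  exists2 F1, indep s F1 & forall x, pderivable s F x /\ pderiv s F x = F1 x.
Proof.
move=> [F0 [F1 [i0 i1 FE]]]; exists F1 => // x.
rewrite (_ : F = fun y => F0 y + y s * F1 y); last exact/funext.
have d0 := pderivable_indep x i0; have d1 := pderivable_indep x i1.
have ds := pderivable_coord s s x.
split; first exact: (pderivableD d0 (pderivableM ds d1)).
rewrite (pderivD d0 (pderivableM ds d1)) (pderivM ds d1) (pderiv_indep x i0).
by rewrite (pderiv_indep x i1) pderiv_coord eqxx /=; ring.
Qed.

Lemma pderiv2_affine s F x : affine_in s F -> pderiv s (pderiv s F) x = 0.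
Proof.
move=> /pderiv_affine[F1 i1 FE].
rewrite (_ : pderiv s F = F1); first exact: pderiv_indep.
by apply/funext => y; have [] := FE y.
Qed.

Variables (K : finType) (f : K -> S) (T : tensor R K).

(** [f] tells which variable sits in which tensor slot: [id] gives [mu], [val] gives [xGam]. *)
Definition teval (x : S -> R) : R := tpair (pure (fun u => vec2 1 (x (f u)))) T.

Lemma tevalE x : teval x = \sum_(e : {ffun K -> 'I_2}) (\prod_u vec2 1 (x (f u)) (e u)) * T e.
Proof. by apply: eq_bigr => e _; rewrite ffunE. Qed.

Lemma psmooth_vec2 (F G : (S -> R) -> R) c : psmooth I F -> psmooth I G ->
  psmooth I (fun x => vec2 (F x) (G x) c).
Proof. by rewrite /vec2; case: eqP. Qed.

Lemma psmooth_teval : psmooth I teval.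
Proof.
rewrite (_ : teval = fun x => \sum_(e : {ffun K -> 'I_2}) (\prod_u vec2 1 (x (f u)) (e u)) * T e); last first.
  by apply/funext => x; exact: tevalE.
apply: (psmooth_sum open_I) => e _; apply: (psmoothM open_I); last exact: psmooth_cst.
apply: (psmooth_prod open_I) => u _.
by apply: psmooth_vec2; [exact: psmooth_cst|exact: psmooth_coord].
Qed.

Lemma indep_teval s : (forall u, f u != s) -> indep s teval.
Proof.
move=> fs x t; rewrite /teval; congr tpair; congr pure.
by apply/funext => u; rewrite moveE (negbTE (fs u)).
Qed.

(** For injective [f] the variable [x_s] occurs in at most one factor (1, x_s), and the pairing is
    linear in each factor. *)
Lemma affine_teval s : injective f -> affine_in s teval.
Proof.
move=> f_inj; case: (pickP (fun u => f u == s)) => [u0 /eqP fu0|nf]; last first.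
  exists teval, (fun=> 0); split=> [||x].
  - by apply: indep_teval => u; rewrite nf.
  - by [].
  - by rewrite mulr0 addr0.
(* The sum over multi-indices is split by the entry at [u0]: entry 0 of (1, x_s) contributes 1,
   entry 1 contributes x_s. *)
pose G (c : {ffun K -> 'I_2} -> R) (x : S -> R) :=
  \sum_e c e * ((\prod_(u | u != u0) vec2 1 (x (f u)) (e u)) * T e).
have iG c : indep s (G c).
  move=> x t; apply: eq_bigr => e _; congr (_ * (_ * _)); apply: eq_bigr => u uu0.
  by rewrite moveE -fu0 (inj_eq f_inj) (negbTE uu0).
exists (G (fun e => (e u0 == ord0)%:R)), (G (fun e => (e u0 != ord0)%:R)).
split=> // x; rewrite tevalE /G mulr_sumr -big_split; apply: eq_bigr => e _ /=.
rewrite (bigD1 u0) //= fu0 /vec2; case: (e u0 == ord0) => /=; ring.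
Qed.

End TensorEvaluation.

(** * Pairings with mu, and the elements psi *)

Section FactorizationTensors.
Variables (R : realType) (k : nat) (d : 'I_k -> nat).
Variable Gam : forall j, tensor R (offslot d j).
Implicit Types (x : slot d -> R) (v w : tensor R (slot d)).

Lemma muD x v w : mu x (v + w) = mu x v + mu x w.
Proof. by rewrite -big_split; apply: eq_bigr => e _; rewrite !ffunE mulrDr. Qed.

Lemma muZ x a v : mu x (a *: v) = a * mu x v.
Proof. by rewrite [RHS]mulr_sumr; apply: eq_bigr => e _; rewrite !ffunE mulrCA. Qed.

Lemma mu0 x : mu x 0 = 0.
Proof. by rewrite -(scale0r 0) muZ mul0r. Qed.

Lemma mu_sum x (K : Type) (r : seq K) (F : K -> tensor R (slot d)) :
  mu x (\sum_(i <- r) F i) = \sum_(i <- r) mu x (F i).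
Proof. exact: (big_morph (mu x) (muD x) (mu0 x)). Qed.

Definition slot_of j (r : 'I_(d j)) : slot d := Tagged (fun i => 'I_(d i)) r.
Arguments slot_of : clear implicits.

Lemma prod_slot j (F : slot d -> R) :
  \prod_s F s = (\prod_r F (slot_of j r)) * \prod_(u : offslot d j) F (val u).
Proof.
rewrite (bigID (fun s => tag s == j)) /=; congr (_ * _); last first.
  rewrite (reindex_omap (val : offslot d j -> slot d) insub) => [|s sj]; last by rewrite insubT.
  by apply: eq_bigl => u; rewrite valK eqxx (valP u).
transitivity (\prod_(i | i == j) \prod_r F (slot_of i r)); last by rewrite big_pred1_eq.
rewrite (sig_big_dep (pred1 j) (fun _ _ => true) (fun i r => F (slot_of i r))).
by apply: eq_big => [[i r]|[i r] _] /=; rewrite ?andbT.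
Qed.

(** Glues a multi-index on the slots of group [j] to one on the remaining slots. The default [ord0]
    is never reached: [insub] fails only when the tag is [j]. *)
Definition merge_index j (e1 : {ffun 'I_(d j) -> 'I_2}) (e2 : {ffun offslot d j -> 'I_2}) :
    {ffun slot d -> 'I_2} :=
  [ffun s => if insub s is Some u then e2 u
             else if tag s =P j is ReflectT p then e1 (etagged p) else ord0].

Lemma merge_index_slot j (e1 : {ffun 'I_(d j) -> 'I_2}) e2 r :
  merge_index e1 e2 (slot_of j r) = e1 r.
Proof.
rewrite ffunE insubF /= ?eqxx //; case: eqP => // p.
by rewrite (eq_axiomK p).
Qed.

Lemma merge_index_off j (e1 : {ffun 'I_(d j) -> 'I_2}) e2 (u : offslot d j) :
  merge_index e1 e2 (val u) = e2 u.
Proof. by rewrite ffunE valK. Qed.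

Lemma tpair_ins j (w : slot d -> 'I_2 -> R) (G : tensor R (offslot d j)) (T : tensor R 'I_(d j)) :
  tpair (pure w) (ins G T)
  = tpair (pure (fun r => w (slot_of j r))) T * tpair (pure (fun u => w (val u))) G.
Proof.
rewrite /tpair mulr_suml.
under [RHS]eq_bigr do rewrite mulr_sumr.
rewrite pair_big /=.
rewrite (reindex (fun p : {ffun 'I_(d j) -> 'I_2} * {ffun offslot d j -> 'I_2} =>
  merge_index p.1 p.2)) /=; last first.
  exists (fun e => ([ffun r => e (slot_of j r)], [ffun u => e (val u)])) => [[e1 e2]|e] _ /=.
    by congr pair; apply/ffunP => u; rewrite ffunE ?merge_index_slot ?merge_index_off.
  apply/ffunP => s; case: (boolP (tag s == j)) => [/eqP sj|sj].
    case: s sj => i r /= ij; move: r; rewrite ij => r.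
    by rewrite -/(slot_of j r) merge_index_slot ffunE.
  have -> : s = val (Sub s sj : offslot d j) by rewrite SubK.
  by rewrite merge_index_off ffunE.
apply: eq_bigr => [[e1 e2]] _ /=; rewrite !ffunE (prod_slot j).
have -> : \prod_r w (slot_of j r) (merge_index e1 e2 (slot_of j r)) = \prod_r w (slot_of j r) (e1 r).
  by apply: eq_bigr => r _; rewrite merge_index_slot.
have -> : \prod_(u : offslot d j) w (val u) (merge_index e1 e2 (val u)) = \prod_u w (val u) (e2 u).
  by apply: eq_bigr => u _; rewrite merge_index_off.
have -> : [ffun r => merge_index e1 e2 (Tagged (fun i => 'I_(d i)) r)] = e1.
  by apply/ffunP => r; rewrite ffunE -/(slot_of j r) merge_index_slot.
have -> : [ffun u : offslot d j => merge_index e1 e2 (val u)] = e2.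
  by apply/ffunP => u; rewrite ffunE merge_index_off.
by ring.
Qed.

Lemma tpair_pure (S : finType) (v w : S -> 'I_2 -> R) :
  tpair (pure v) (pure w) = \prod_s \sum_c v s c * w s c.
Proof.
rewrite bigA_distr_bigA; apply: eq_bigr => e _.
by rewrite !ffunE -big_split.
Qed.

(** Slot by slot, (1, x_s) pairs with (y, -1) to y - x_s. *)
Lemma mu_psi x j y :
  mu x (psi Gam j y) = (\prod_(s | tag s == j) (y - x s)) * xGam Gam x j.
Proof.
rewrite /mu tpair_ins tpair_pure; congr (_ * _).
transitivity (\prod_(i | i == j) \prod_r \sum_c vec2 1 (x (slot_of i r)) c * vec2 y (-1) c).
  by rewrite big_pred1_eq.
rewrite (sig_big_dep (pred1 j) (fun _ _ => true)
  (fun i (r : 'I_(d i)) => \sum_c vec2 1 (x (slot_of i r)) c * vec2 y (-1) c)).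
apply: eq_big => [[i r]|[i r] _] /=; rewrite ?andbT //.
by rewrite big_ord_recl big_ord1 /vec2 /=; ring.
Qed.

(** A tensor power of a single vector is symmetric: permuting slots merely reindexes the product. *)
Lemma psi_in j y : psi Gam j y \in fact_space Gam.
Proof.
apply: (subvP (sumv_sup j _ (subvv _))) => //.
rewrite /psi -lfunE; apply: memv_img; rewrite memvE; apply/subv_bigcapP => s _.
rewrite -memvE; apply/fixedSpaceP; rewrite lfunE; apply/ffunP => e.
rewrite !ffunE [RHS](reindex_inj (@perm_inj _ s)) /=.
by apply: eq_bigr => r _; rewrite ffunE.
Qed.

Variables (m : nat) (beta : tensor R (slot d)) (e : m.-tuple (tensor R (slot d))).
Hypothesis he : basis_of (fact_space Gam) (beta :: e).

(** The point is that [c] is the same for all [x]: divided by <mu, beta>, the [beta]-component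
    becomes an additive constant, which differentiation kills. *)
Lemma mu_coord v : v \in fact_space Gam -> exists c, forall x,
  mu x v = c * mu x beta + \sum_a coord_mod_beta beta e a v * mu x (tnth e a).
Proof.
move=> vh; exists (coord [tuple of beta :: e] ord0 v) => y.
have vspan : v \in <<[tuple of beta :: e]>>%VS by rewrite (span_basis he).
rewrite {1}(coord_span vspan) mu_sum big_ord_recl /= muZ; congr (_ + _).
by apply: eq_bigr => a _; rewrite muZ (tnth_nth 0).
Qed.

Lemma mem_basis_h a : tnth e a \in fact_space Gam.
Proof. by rewrite (basis_mem he) // inE mem_tnth orbT. Qed.

(** The components of psi in the standard basis [dl] are polynomial in the variable, and taking
    coordinates is linear. *)
Lemma psmooth_coord_psi (I : slot d -> set R) (open_I : forall s, open (I s)) a j s :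
  psmooth I (fun x => coord_mod_beta beta e a (psi Gam j (x s))).
Proof.
pose dl (f : {ffun slot d -> 'I_2}) : tensor R (slot d) := [ffun f' => (f' == f)%:R].
have dE v : v = \sum_f v f *: dl f.
  apply/ffunP => f'; rewrite sum_ffunE (bigD1 f') //= !ffunE eqxx big1 ?addr0 => [|f ff'].
    by rewrite [RHS]mulr1.
  by rewrite !ffunE eq_sym (negbTE ff') [LHS]mulr0.
rewrite (_ : (fun x => _) = fun x => \sum_(f : {ffun slot d -> 'I_2}) (\prod_(r : 'I_(d j)) vec2 (x s) (-1) (f (slot_of j r)))
   * (Gam j [ffun u => f (val u)] * coord_mod_beta beta e a (dl f))).
  apply: (psmooth_sum open_I) => f _; apply: (psmoothM open_I); last exact: psmooth_cst.
  apply: (psmooth_prod open_I) => r _.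
  by apply: psmooth_vec2; [exact: psmooth_coord|exact: psmooth_cst].
apply/funext => x; rewrite {1}(dE (psi Gam j (x s))) /coord_mod_beta linear_sum.
apply: eq_bigr => f _; rewrite linearZ /= !ffunE mulrA; congr (_ * _ * _).
by apply: eq_bigr => r _; rewrite ffunE.
Qed.

Lemma card_slot : #|slot d| = (\sum_(j < k) d j)%N.
Proof.
rewrite card_tagged sumnE big_map big_enum /=.
by apply: eq_bigr => j _; rewrite card_ord.
Qed.

End FactorizationTensors.

(** * Functions affine in one variable, and their quotients *)

Section AffineFunctions.
Variables (R : realType) (S : finType) (I : S -> set R).
Hypothesis open_I : forall s, open (I s).
Implicit Types (s : S) (F G : (S -> R) -> R).

Lemma pderiv_eq_line s F G x : (forall t, F (move s x t) = G (move s x t)) ->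
  pderiv s F x = pderiv s G x.
Proof.
move=> FG; rewrite !pderivE.
by rewrite (_ : (fun t => _) = fun t => G (move s x t)) //; exact/funext.
Qed.

Lemma indepM s F G : indep s F -> indep s G -> indep s (fun x => F x * G x).
Proof. by move=> iF iG x t; rewrite iF iG. Qed.

Lemma indep_coord s u : u != s -> indep s (fun x : S -> R => x u).
Proof. by move=> us x t; rewrite moveE (negbTE us). Qed.

Lemma affineM s F G : indep s F -> affine_in s G -> affine_in s (fun x => F x * G x).
Proof.
move=> iF [G0 [G1 [i0 i1 GE]]]; exists (fun x => F x * G0 x), (fun x => F x * G1 x).
by split=> [||x]; [exact: indepM|exact: indepM|rewrite GE; ring].
Qed.

Lemma pderivable_affine s F x : affine_in s F -> pderivable s F x.
Proof. by move=> /pderiv_affine[F1 _ /(_ x)[]]. Qed.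

Lemma pderivable_pderiv_affine s F x : affine_in s F -> pderivable s (pderiv s F) x.
Proof.
move=> /pderiv_affine[F1 i1 FE].
rewrite (_ : pderiv s F = F1); first exact: pderivable_indep.
by apply/funext => y; have [] := FE y.
Qed.

Lemma pderiv_div s F G x : G x != 0 -> pderivable s F x -> pderivable s G x ->
  pderiv s (fun y => F y / G y) x
  = (pderiv s F x * G x - F x * pderiv s G x) / G x ^+ 2.
Proof.
move=> G0 dF dG; rewrite (pderivM dF (pderivableV G0 dG)) pderivV //.
by field.
Qed.

Lemma pderivable_div s F G x : G x != 0 -> pderivable s F x -> pderivable s G x ->
  pderivable s (fun y => F y / G y) x.
Proof. by move=> G0 dF dG; exact: (pderivableM dF (pderivableV G0 dG)). Qed.

(** [(F/G)' = W / G^2] with [W = F' G - F G'], and [W' = 0] because [F'' = G'' = 0]; so [(F/G)'] has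
    logarithmic derivative [- 2 G'/G]. *)
Lemma pderiv2_affine_div s F G x : affine_in s F -> affine_in s G ->
  (forall y, box I y -> G y != 0) -> box I x ->
  pderiv s (pderiv s (fun y => F y / G y)) x
  = - 2 * pderiv s G x / G x * pderiv s (fun y => F y / G y) x.
Proof.
move=> aF aG G0 bx.
have dF y := pderivable_affine y aF; have dG y := pderivable_affine y aG.
have ddF y := pderivable_pderiv_affine y aF; have ddG y := pderivable_pderiv_affine y aG.
have FG y : box I y -> pderiv s (fun y => F y / G y) y =
    (pderiv s F y * G y - F y * pderiv s G y) / (G y * G y).
  by move=> By; rewrite pderiv_div ?expr2 // G0.
rewrite (pderiv_eq_box open_I _ FG bx) (FG _ bx).
have dN : pderivable s (fun y => pderiv s F y * G y - F y * pderiv s G y) x.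
  by apply: pderivableB; exact: pderivableM.
have dGG : pderivable s (fun y => G y * G y) x by exact: pderivableM.
rewrite (pderiv_div _ dN dGG) ?mulf_neq0 ?G0 //.
rewrite pderivB; [|exact: pderivableM|exact: pderivableM].
rewrite !pderivM // !pderiv2_affine //.
by field; exact: G0.
Qed.

End AffineFunctions.

(** Enumerating both index sets by the same ordinal makes the families square matrices, for which a
    right inverse is a left inverse. *)
Lemma finite_left_inverse (R : realType) (K L : finType) (P : K -> L -> R) (Q : L -> K -> R) :
  #|K| = #|L| -> (forall s u, \sum_i P s i * Q i u = (s == u)%:R) ->
  forall i j, \sum_s Q i s * P s j = (i == j)%:R.
Proof.
move=> KL PQ.
suff : forall n (h : #|L| = n) (h' : #|K| = n) i j, \sum_s Q i s * P s j = (i == j)%:R.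
  by move/(_ _ erefl KL).
move=> n h h' i j.
pose p : 'M[R]_n := \matrix_(a, c) P (enum_val (cast_ord (esym h') a)) (enum_val (cast_ord (esym h) c)).
pose q : 'M[R]_n := \matrix_(c, a) Q (enum_val (cast_ord (esym h) c)) (enum_val (cast_ord (esym h') a)).
have reK (F : K -> R) : \sum_s F s = \sum_(a < n) F (enum_val (cast_ord (esym h') a)).
  rewrite (reindex (fun a : 'I_n => enum_val (cast_ord (esym h') a))) //.
  exists (fun s => cast_ord h' (enum_rank s)) => s _; first by rewrite enum_valK cast_ordKV.
  by rewrite cast_ordK enum_rankK.
have reL (F : L -> R) : \sum_s F s = \sum_(a < n) F (enum_val (cast_ord (esym h) a)).
  rewrite (reindex (fun a : 'I_n => enum_val (cast_ord (esym h) a))) //.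
  exists (fun s => cast_ord h (enum_rank s)) => s _; first by rewrite enum_valK cast_ordKV.
  by rewrite cast_ordK enum_rankK.
have /mulmx1C qp : p *m q = 1%:M.
  apply/matrixP => a c; rewrite !mxE.
  rewrite -(inj_eq (@cast_ord_inj _ _ (esym h'))) -(inj_eq enum_val_inj) -PQ reL.
  by apply: eq_bigr => l _; rewrite !mxE.
have /matrixP/(_ (cast_ord h (enum_rank i)) (cast_ord h (enum_rank j))) := qp.
rewrite !mxE (inj_eq (@cast_ord_inj _ _ h)) (inj_eq enum_rank_inj) => <-.
by rewrite reK; apply: eq_bigr => a _; rewrite !mxE !cast_ordK !enum_rankK.
Qed.

(** * Functions with zero gradient on a product of intervals *)

Section ConstantOnBox.
Variables (R : realType) (S : finType) (I : S -> set R).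
Hypothesis interval_I : forall s, is_interval (I s).

Lemma line_constant (f : R -> R) (U : set R) a c : is_interval U -> U a -> U c ->
  (forall t, U t -> is_derive t 1 (f : R -> R^o) 0) -> f a = f c.
Proof.
move=> iU; wlog ac : a c / a <= c => [H Ua Uc df|Ua Uc df].
  by case: (leP a c) => [/H|/ltW/H h]; [exact|apply/esym/h].
have Ut t : a <= t <= c -> U t by move=> tac; exact: (iU _ _ Ua Uc t tac).
have [| |t _] := @MVT_segment R f (fun=> 0) a c ac.
- by move=> t /itvP tac; apply: df; apply: Ut; rewrite !tac.
- apply: derivable_within_continuous => t /itvP tac.
  by have [] := df t (Ut t _); rewrite ?tac.
by rewrite mul0r => /eqP; rewrite subr_eq0 => /eqP.
Qed.

(** Passes from [x] to [y] one coordinate at a time; in a product every intermediate point [mix r]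
    stays in the box. *)
Lemma constant_on_box (F : (S -> R) -> R) :
  (forall s x, box I x -> pderivable s F x /\ pderiv s F x = 0) ->
  forall x y, box I x -> box I y -> F x = F y.
Proof.
move=> dF x y bx By.
have one s z t : box I z -> I s t -> F (move s z t) = F z.
  move=> bz It; rewrite -[in RHS](move_id s z).
  apply: (@line_constant (fun t => F (move s z t)) (I s)) => // u Iu.
  have [[du] pu] := dF s _ (box_move bz Iu).
  have E : (fun v => F (move s (move s z u) v)) = fun v => F (move s z v).
    by apply/funext => v; rewrite move_move.
  have zu : move s z u s = u by rewrite moveE eqxx.
  move: du pu; rewrite pderivE E zu => du pu.
  by split.
pose mix (r : seq S) := fun s => if s \in r then y s else x s.
have mixE r : box I (mix r) /\ F (mix r) = F x.
  elim: r => [|s r [br Fr]]; first by split.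
  rewrite -Fr (_ : mix (s :: r) = move s (mix r) (y s)); last first.
    by apply/funext => u; rewrite /mix moveE inE; case: eqP => // ->.
  by split; [exact: box_move|exact: one].
have [_ <-] := mixE (enum S); congr F; apply/funext => s.
by rewrite /mix mem_enum.
Qed.

End ConstantOnBox.

(** * Killing fields tangent to the torus fibres *)

Section VerticalKilling.
Variables (R : realType) (S : finType) (m : nat) (I : S -> set R).
Hypothesis open_I : forall s, open (I s).
Variable g : field2 R (S + 'I_m)%type.
Variables (b : S -> (S -> R) -> R) (H Hi : 'I_m -> 'I_m -> (S -> R) -> R).
Hypothesis HHi : forall i j x, box I x -> \sum_l H i l x * Hi l j x = (i == j)%:R.
Hypothesis gE : forall p, box I (base p) -> forall c e, g p c e = block_metric b H c e (base p).
Variables (X : vfield R (S + 'I_m)%type) (Z : 'I_m -> (S -> R) -> R).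
Hypothesis XE_base : forall p s, box I (base p) -> X p (inl s) = 0.
Hypothesis XE_fiber : forall p i, box I (base p) -> X p (inr i) = Z i (base p).

(** The metric does not depend on the angles, so only derivatives of the components of [X] remain in
    the Lie derivative. Its (x_s, t_j) entry is [\sum_l H l j * d_s Z_l], and [H] is invertible. *)
Lemma killing_vertical (D : set (S + 'I_m -> R)) :
  (forall p, D p <-> box I (base p)) ->
  killing D g X <-> forall s i x, box I x -> pderiv s (Z i) x = 0.
Proof.
move=> DE.
have eqn p a c : box I (base p) ->
  \sum_l (X p l * pderiv l (fun q => g q a c) p + g p l c * pderiv a (fun q => X q l) p
          + g p a l * pderiv c (fun q => X q l) p)
  = \sum_l (block_metric b H (inr l) c (base p) * pderiv_base a (Z l) (base p)
            + block_metric b H a (inr l) (base p) * pderiv_base c (Z l) (base p)).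
  move=> bp; rewrite big_sumType /= big1 ?add0r => [|s _].
    apply: eq_bigr => l _.
    rewrite (pderiv_baseE open_I _ (fun q bq => gE bq a c) bp) /= mulr0 add0r !gE //.
    by rewrite !(pderiv_baseE open_I _ (fun q bq => XE_fiber l bq) bp).
  have zX d : pderiv d (fun q => X q (inl s)) p = 0.
    rewrite (@pderiv_baseE _ _ _ _ open_I d _ (fun=> 0) p) => // [|q bq]; last exact: XE_base.
    by case: d => //= u; rewrite pderiv_cst.
  rewrite XE_base // mul0r add0r !zX.
  by rewrite !mulr0 addr0.
split=> [kX s i x bx|dZ p /DE bp a c]; last first.
  rewrite eqn // big1 // => l _.
  have D0 d : pderiv_base d (Z l) (base p) = 0 by case: d => //= u; rewrite dZ.
  by rewrite !D0 !mulr0 addr0.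
pose p (c : S + 'I_m) : R := if c is inl u then x u else 0.
have px : base p = x by apply/funext.
have bp : box I (base p) by rewrite px.
have E j : \sum_l H l j x * pderiv s (Z l) x = 0.
  have := kX p (proj2 (DE p) bp) (inl s) (inr j); rewrite eqn // px /=.
  by under eq_bigr do rewrite mul0r addr0.
transitivity (\sum_l (\sum_j H l j x * Hi j i x) * pderiv s (Z l) x).
  rewrite (bigD1 i) //= HHi // eqxx mul1r big1 ?addr0 // => l li.
  by rewrite HHi // (negbTE li) mul0r.
under eq_bigr do rewrite mulr_suml.
rewrite exchange_big big1 // => j _ /=.
transitivity (Hi j i x * \sum_l H l j x * pderiv s (Z l) x); last by rewrite E mulr0.
by rewrite mulr_sumr; apply: eq_bigr => l _; ring.
Qed.

End VerticalKilling.

(** * The separable geometry *)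

Section SeparableGeometry.
Variables (R : realType) (k : nat) (d : 'I_k -> nat) (m : nat).
Hypothesis hm : m = (\sum_(j < k) d j)%N.
Variable Gam : forall j, tensor R (offslot d j).
Variables (beta : tensor R (slot d)) (e : m.-tuple (tensor R (slot d))).
Hypothesis he : basis_of (fact_space Gam) (beta :: e).
Variable I : slot d -> set R.
Hypothesis open_I : forall s, open (I s).
Hypothesis Delta0 : forall x, box I x -> forall s, Delta x s != 0.
Hypothesis xGam0 : forall x, box I x -> forall j, xGam Gam x j != 0.
Hypothesis mu_beta0 : forall x, box I x -> mu x beta != 0.
Variable A : slot d -> R -> R.
Hypothesis smooth_A : forall s, smooth_on (I s) (A s).
Hypothesis A0 : forall s y, I s y -> A s y != 0.
Implicit Types (s t u : slot d) (x : slot d -> R).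

(** The value of [x_t] in Delta_t is replaced by [Y]: the choice [Y = x_t] gives [sep_num t], a
    constant [y] gives the cofactor of [y - x_t] in <mu, psi_t(y)>. *)
Definition shifted_num t (Y : (slot d -> R) -> R) x : R :=
  (\prod_(u | (tag u == tag t) && (u != t)) (Y x - x u)) * xGam Gam x (tag t).

Definition sep_num t x : R := Delta x t * xGam Gam x (tag t).

Lemma sep_numE t : sep_num t = shifted_num t (fun x => x t).
Proof. by []. Qed.

Lemma mu_psi_slot x t y : mu x (psi Gam (tag t) y) = (y - x t) * shifted_num t (fun=> y) x.
Proof. by rewrite mu_psi (bigD1 t) //= mulrA. Qed.

(** [Gam j] has no slot with tag [j]. *)
Lemma indep_xGam s j : tag s = j -> indep s (fun x => xGam Gam x j).
Proof.
move=> <-; apply: (@indep_teval _ _ _ val) => u.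
by apply: contraNneq (valP u) => ->.
Qed.

Lemma indep_prod u (K : Type) (r : seq K) (Q : pred K) (F : K -> (slot d -> R) -> R) :
  (forall i, Q i -> indep u (F i)) -> indep u (fun x => \prod_(i <- r | Q i) F i x).
Proof. by move=> iF x y; apply: eq_bigr => i Qi; exact: iF. Qed.

(** If [u] and [t] share a group, [x_u] occurs in the single factor [Y - x_u] and not in [xGam];
    otherwise it occurs in [xGam] alone. *)
Lemma affine_shifted_num t u Y : indep u Y -> u != t -> affine_in u (shifted_num t Y).
Proof.
move=> iY ut; have iB s : s != u -> indep u (fun x => Y x - x s).
  by move=> su x y; rewrite iY indep_coord.
have [tut|tut] := eqVneq (tag u) (tag t).
  pose F x := \prod_(s | (tag s == tag t) && (s != t) && (s != u)) (Y x - x s) * xGam Gam x (tag t).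
  rewrite (_ : shifted_num t Y = fun x => F x * (Y x - x u)).
    apply: affineM.
      apply: indepM; last exact: indep_xGam.
      by apply: indep_prod => s /andP[_]; exact: iB.
    exists Y, (fun=> - 1); split=> // x; ring.
  apply/funext => x; rewrite /shifted_num (bigD1 u) /=; last by rewrite tut eqxx.
  by rewrite /F; ring.
apply: affineM; last by apply: affine_teval; exact: val_inj.
apply: indep_prod => s /andP[/eqP st _]; apply: iB.
by apply: contraNneq tut => <-; rewrite st.
Qed.

Lemma affine_mu s v : affine_in s (fun x => mu x v).
Proof. by apply: (@affine_teval _ _ _ id). Qed.

Lemma psmooth_mu v : psmooth I (fun x => mu x v).
Proof. exact: (psmooth_teval open_I id). Qed.

Lemma psmooth_xGam j : psmooth I (fun x => xGam Gam x j).
Proof. exact: (psmooth_teval open_I val). Qed.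

Lemma psmooth_Delta s : psmooth I (fun x => Delta x s).
Proof.
apply: (psmooth_prod open_I) => u _.
by apply: (psmoothB open_I); exact: psmooth_coord.
Qed.

Lemma psmooth_sep_num s : psmooth I (sep_num s).
Proof. by apply: (psmoothM open_I); [exact: psmooth_Delta|exact: psmooth_xGam]. Qed.

Lemma psmooth_A s : psmooth I (fun x => A s (x s)).
Proof. exact: (psmooth_comp_coord open_I). Qed.

Lemma sep_num0 s x : box I x -> sep_num s x != 0.
Proof. by move=> bx; rewrite mulf_neq0 ?Delta0 ?xGam0. Qed.

Lemma A_neq0 s x : box I x -> A s (x s) != 0.
Proof. by move=> bx; apply: A0; exact: bx. Qed.

(** * The frame of the separable geometry and its derivatives *)

Definition sep_coef s x : R := sep_num s x / (A s (x s) * mu x beta).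

Definition affine_coord (v : tensor R (slot d)) x : R := mu x v / mu x beta.

Definition sep_frame s (a : 'I_m) x : R := pderiv s (affine_coord (tnth e a)) x.

Definition psi_coord (a : 'I_m) s x : R := coord_mod_beta beta e a (psi Gam (tag s) (x s)).

(** The inverse frame is the vector of coordinates of psi_s(x_s), normalised: its pairing with the
    frame is [- sep_eta], whence the sign and the factor. *)
Definition sep_coframe (a : 'I_m) s x : R := - psi_coord a s x * mu x beta / sep_num s x.

Definition sep_kap s x : R := - 2 * pderiv s (fun y => mu y beta) x / mu x beta.

Lemma sep_coef0 s x : box I x -> sep_coef s x != 0.
Proof.
move=> bx; rewrite mulf_neq0 ?sep_num0 // invr_neq0 // mulf_neq0 ?mu_beta0 //.
exact: A_neq0.
Qed.

Lemma psmooth_sep_coef s : psmooth I (sep_coef s).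
Proof.
apply: (psmooth_div open_I) => [y By||]; last 2 first.
- exact: psmooth_sep_num.
- by apply: (psmoothM open_I); [exact: psmooth_A|exact: psmooth_mu].
by rewrite mulf_neq0 ?mu_beta0 // A_neq0.
Qed.

Lemma psmooth_affine_coord v : psmooth I (affine_coord v).
Proof. by apply: (psmooth_div open_I); [exact: mu_beta0|exact: psmooth_mu|exact: psmooth_mu]. Qed.

Lemma psmooth_sep_frame s a : psmooth I (sep_frame s a).
Proof. by apply: psmooth_pderiv; exact: psmooth_affine_coord. Qed.

Lemma psmooth_sep_coframe a s : psmooth I (sep_coframe a s).
Proof.
apply: (psmooth_div open_I); [exact: sep_num0| |exact: psmooth_sep_num].
apply: (psmoothM open_I); last exact: psmooth_mu.
by apply: (psmoothN open_I); exact: psmooth_coord_psi.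
Qed.

Lemma psmooth_sep_kap s : psmooth I (sep_kap s).
Proof.
apply: (psmooth_div open_I); [exact: mu_beta0| |exact: psmooth_mu].
apply: (psmoothM open_I); first exact: psmooth_cst.
by apply: psmooth_pderiv; exact: psmooth_mu.
Qed.

Lemma sep_kap_deriv s x : box I x -> pderiv s (sep_kap s) x = sep_kap s x ^+ 2 / 2.
Proof.
move=> bx; have am := affine_mu s beta.
have ddm := pderivable_pderiv_affine x am.
rewrite (pderiv_div (mu_beta0 bx) (pderivableZ _ ddm) (pderivable_affine x am)).
rewrite (pderivZ _ ddm) (pderiv2_affine x am) /sep_kap.
by field; exact: mu_beta0.
Qed.

Lemma sep_frame_diag s a x : box I x ->
  pderiv s (sep_frame s a) x = sep_kap s x * sep_frame s a x.
Proof.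
move=> bx.
exact: (pderiv2_affine_div open_I (affine_mu s _) (affine_mu s _) mu_beta0 bx).
Qed.

Lemma sep_coef_deriv2 s u x : u != s -> box I x ->
  pderiv s (pderiv s (sep_coef u)) x = sep_kap s x * pderiv s (sep_coef u) x.
Proof.
move=> us bx.
have -> : sep_coef u = fun x => ((A u (x u))^-1 * sep_num u x) / mu x beta.
  by apply/funext => y; rewrite /sep_coef invfM mulrA [_^-1 * _]mulrC.
apply: (pderiv2_affine_div open_I _ (affine_mu s _) mu_beta0 bx).
apply: affineM; first by move=> y t; rewrite indep_coord.
by rewrite sep_numE; apply: affine_shifted_num; [exact: indep_coord|rewrite eq_sym].
Qed.

(** [sep_coef s] without [A s]. Since [A u] depends on [x_u] only, both have the same logarithmic
    derivatives along [x_s] for [u != s]. *)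
Definition sep_eta s x : R := sep_num s x / mu x beta.

Lemma psmooth_sep_eta s : psmooth I (sep_eta s).
Proof.
by apply: (psmooth_div open_I); [exact: mu_beta0|exact: psmooth_sep_num|exact: psmooth_mu].
Qed.

Lemma sep_eta0 s x : box I x -> sep_eta s x != 0.
Proof. by move=> bx; rewrite mulf_neq0 ?sep_num0 // invr_neq0 // mu_beta0. Qed.

Lemma dlog_sep_coef s u x : u != s -> box I x ->
  dlog sep_coef s u x = pderiv s (sep_eta u) x / sep_eta u x.
Proof.
move=> us bx; have iA : indep s (fun y => (A u (y u))^-1).
  by move=> y t; rewrite indep_coord.
rewrite /dlog.
have -> : sep_coef u = fun x => (A u (x u))^-1 * sep_eta u x.
  by apply/funext => y; rewrite /sep_coef /sep_eta invfM mulrCA.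
rewrite (pderivM (pderivable_indep x iA) (psmooth_pderivable s (psmooth_sep_eta u) bx)).
rewrite (pderiv_indep x iA) mul0r add0r.
by field; rewrite sep_eta0 ?A_neq0.
Qed.

(* sep_eta t with x_t frozen at y: the cofactor of y - x_t in <mu_beta, psi_t(y)>. *)
Definition shifted_eta t y x : R := shifted_num t (fun=> y) x / mu x beta.

Lemma psmooth_shifted_eta t y : psmooth I (shifted_eta t y).
Proof.
apply: (psmooth_div open_I); [exact: mu_beta0| |exact: psmooth_mu].
apply: (psmoothM open_I); last exact: psmooth_xGam.
apply: (psmooth_prod open_I) => u _.
by apply: (psmoothB open_I); [exact: psmooth_cst|exact: psmooth_coord].
Qed.

(** The line in direction [s] does not move [x_t], so freezing [x_t] changes nothing. *)
Lemma pderiv_shifted_eta s t x : s != t ->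
  pderiv s (shifted_eta t (x t)) x = pderiv s (sep_eta t) x.
Proof.
move=> st; apply: pderiv_eq_line => y.
by rewrite /sep_eta sep_numE /shifted_eta /shifted_num moveE eq_sym (negbTE st).
Qed.

Lemma affine_coord_psi t y x :
  affine_coord (psi Gam (tag t) y) x = (y - x t) * shifted_eta t y x.
Proof. by rewrite /affine_coord /shifted_eta mu_psi_slot mulrA. Qed.

Lemma pderiv_affine_coord_psi u t y x : box I x ->
  pderiv u (affine_coord (psi Gam (tag t) y)) x
  = - (t == u)%:R * shifted_eta t y x + (y - x t) * pderiv u (shifted_eta t y) x.
Proof.
move=> bx.
rewrite (_ : affine_coord _ = fun x => (y - x t) * shifted_eta t y x); last first.
  by apply/funext => z; exact: affine_coord_psi.
have dx := pderivable_coord u t x; have dc := pderivable_cst u y x.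
rewrite (pderivM (pderivableB dc dx) (psmooth_pderivable u (psmooth_shifted_eta t y) bx)).
by rewrite (pderivB dc dx) pderiv_cst pderiv_coord sub0r.
Qed.

Lemma pderiv2_affine_coord_psi s u t x : box I x ->
  pderiv s (pderiv u (affine_coord (psi Gam (tag t) (x t)))) x
  = - (t == u)%:R * pderiv s (shifted_eta t (x t)) x
    - (t == s)%:R * pderiv u (shifted_eta t (x t)) x.
Proof.
(* [y] is a constant for the differentiation and equals [x_t] only at the point of evaluation; there
   the terms that still contain [y - x_t] vanish. *)
move=> bx; set y := x t; have sh := psmooth_shifted_eta t y.
rewrite (pderiv_eq_box open_I _ (pderiv_affine_coord_psi u t y) bx).
have dx := pderivable_coord s t x; have dc := pderivable_cst s y x.
have dh := psmooth_pderivable s sh bx.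
have ddh := psmooth_pderivable s (psmooth_pderiv u sh) bx.
rewrite (pderivD (pderivableZ _ dh) (pderivableM (pderivableB dc dx) ddh)).
rewrite (pderivM (pderivableB dc dx) ddh) (pderivZ _ dh) (pderivB dc dx).
by rewrite pderiv_cst pderiv_coord /y; ring.
Qed.

Lemma affine_coord_expand v : v \in fact_space Gam -> exists c, forall x, box I x ->
  affine_coord v x = c + \sum_a coord_mod_beta beta e a v * affine_coord (tnth e a) x.
Proof.
move=> /(mu_coord he)[c vE]; exists c => x bx.
rewrite /affine_coord vE mulrDl mulfK ?mu_beta0 //; congr (_ + _).
by rewrite mulr_suml; apply: eq_bigr => a _; rewrite mulrA.
Qed.

Lemma pderiv_affine_coord_expand v u x : v \in fact_space Gam -> box I x ->
  pderiv u (affine_coord v) x = \sum_a coord_mod_beta beta e a v * sep_frame u a x.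
Proof.
move=> /affine_coord_expand[c vE] bx; rewrite (pderiv_eq_box open_I _ vE bx).
have da a := psmooth_pderivable u (psmooth_affine_coord (tnth e a)) bx.
have dZ a : pderivable u (fun y => coord_mod_beta beta e a v * affine_coord (tnth e a) y) x.
  exact: pderivableZ.
rewrite (pderivD (pderivable_cst _ _ _) (pderivable_sum _ (fun a _ => dZ a))).
rewrite pderiv_cst add0r pderiv_sum //.
by apply: eq_bigr => a _; rewrite pderivZ.
Qed.

Lemma pderiv2_affine_coord_expand v s u x : v \in fact_space Gam -> box I x ->
  pderiv s (pderiv u (affine_coord v)) x
  = \sum_a coord_mod_beta beta e a v * pderiv s (sep_frame u a) x.
Proof.
move=> vh bx.
have vE y : box I y -> pderiv u (affine_coord v) y
    = \sum_a coord_mod_beta beta e a v * sep_frame u a y.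
  exact: pderiv_affine_coord_expand.
rewrite (pderiv_eq_box open_I _ vE bx).
have da a := psmooth_pderivable s (psmooth_sep_frame u a) bx.
rewrite pderiv_sum => [|a _]; last exact: pderivableZ.
by apply: eq_bigr => a _; rewrite pderivZ.
Qed.

Lemma sep_frame_psi u t x : box I x ->
  \sum_a psi_coord a t x * sep_frame u a x = - (t == u)%:R * sep_eta t x.
Proof.
move=> bx; rewrite -pderiv_affine_coord_expand ?psi_in // pderiv_affine_coord_psi //.
by rewrite subrr mul0r addr0.
Qed.

Lemma sep_frameK s u x : box I x ->
  \sum_a sep_frame s a x * sep_coframe a u x = (s == u)%:R.
Proof.
move=> bx.
transitivity (- (\sum_a psi_coord a u x * sep_frame s a x) / sep_eta u x).
  rewrite -sumrN mulr_suml; apply: eq_bigr => a _.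
  by rewrite /sep_coframe /sep_eta; field; rewrite sep_num0 ?mu_beta0.
by rewrite sep_frame_psi // eq_sym; field; exact: sep_eta0.
Qed.

(** There are as many slots as angular coordinates, so the one-sided inverse of [sep_frameK] is
    two-sided. *)
Lemma sep_coframeK a c x : box I x ->
  \sum_s sep_coframe a s x * sep_frame s c x = (a == c)%:R.
Proof.
move=> bx; apply: (@finite_left_inverse _ _ _ (fun s a => sep_frame s a x)
  (fun a s => sep_coframe a s x)) => [|s u]; last exact: sep_frameK.
by rewrite card_slot card_ord hm.
Qed.

(** The defect [E] of the identity is a covector on the torus Lie algebra. It vanishes on every
    psi_t(x_t), and these span by [sep_coframeK]. *)
Lemma sep_frame_off s u a x : u != s -> box I x ->
  pderiv s (sep_frame u a) x
  = dlog sep_coef s u x * sep_frame u a x + dlog sep_coef u s x * sep_frame s a x.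
Proof.
move=> us bx; have su : s != u by rewrite eq_sym.
pose E c := pderiv s (sep_frame u c) x - dlog sep_coef s u x * sep_frame u c x
            - dlog sep_coef u s x * sep_frame s c x.
suff : E a = 0 by move=> /eqP; rewrite /E -addrA -opprD subr_eq0 => /eqP.
have Epsi t : \sum_c psi_coord c t x * E c = 0.
  transitivity (pderiv s (pderiv u (affine_coord (psi Gam (tag t) (x t)))) x
    - dlog sep_coef s u x * (\sum_c psi_coord c t x * sep_frame u c x)
    - dlog sep_coef u s x * (\sum_c psi_coord c t x * sep_frame s c x)).
    rewrite pderiv2_affine_coord_expand ?psi_in // !mulr_sumr -!sumrB.
    by apply: eq_bigr => c _; rewrite /E -/(psi_coord c t x); ring.
  rewrite pderiv2_affine_coord_psi // !sep_frame_psi // !dlog_sep_coef //.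
  (* For [t = u] the second derivative is [- d_s eta_u], cancelled by the first [dlog] term; for
     [t = s] the roles of [s] and [u] are exchanged; for other [t] every term is 0. *)
  have [->|tu] := eqVneq t u.
    rewrite (negbTE us) pderiv_shifted_eta //=.
    by field; rewrite !sep_eta0.
  have [->|ts] := eqVneq t s; last by rewrite /=; ring.
  by rewrite (pderiv_shifted_eta x us) /=; field; rewrite !sep_eta0.
transitivity (\sum_t - (sep_eta t x)^-1 * sep_frame t a x * \sum_c psi_coord c t x * E c); last first.
  by rewrite big1 // => t _; rewrite Epsi mulr0.
transitivity (\sum_c (\sum_t sep_coframe c t x * sep_frame t a x) * E c).
  rewrite (bigD1 a) //= sep_coframeK // eqxx mul1r big1 ?addr0 // => c ca.
  by rewrite sep_coframeK // (negbTE ca) mul0r.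
under eq_bigr do rewrite mulr_suml.
rewrite exchange_big; apply: eq_bigr => t _ /=; rewrite mulr_sumr.
apply: eq_bigr => c _; rewrite /sep_coframe /sep_eta.
by field; rewrite sep_num0 ?mu_beta0.
Qed.

Lemma sep_metricE p : box I (base p) -> forall c c',
  sep_metric Gam beta e A p c c' = block_metric sep_coef (frame_gram sep_coef sep_frame) c c' (base p).
Proof.
move=> bp c c'; case: c => [s|a]; case: c' => [u|a'] /=.
- rewrite /sep_metric (bigD1 s) //= /dx [X in _ + X]big1 ?addr0 => [|v vs].
    by rewrite eqxx mul0r mulr0 addr0 mul1r eq_sym mulrC; congr (_ * _).
  by rewrite (eq_sym (inl s)) (inj_eq (@inl_inj _ _)) (negbTE vs) !mul0r !mulr0 addr0.
- by rewrite /sep_metric big1 // => v _ /=; rewrite !mulr0 mul0r mulr0 addr0.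
- by rewrite /sep_metric big1 // => v _ /=; rewrite !mul0r !mulr0 addr0.
apply: eq_bigr => v _ /=; rewrite /dx /= mul0r mulr0 add0r; congr (_ * _).
by rewrite /sep_coef invf_div.
Qed.

Lemma scal_sep p : box I (base p) -> let x := base p in
  scal (sep_metric Gam beta e A) p =
  - \sum_s (pderiv s (fun y => (sep_coef s y)^-1 * tau sep_coef sep_kap s y) x
            + lam sep_coef sep_kap s x * ((sep_coef s x)^-1 * tau sep_coef sep_kap s x)).
Proof.
move=> bp; apply: (@scal_frame _ _ m I open_I _ sep_coef sep_frame sep_coframe sep_kap) => //.
- exact: sep_coef0.
- exact: psmooth_sep_coef.
- exact: psmooth_sep_frame.
- exact: psmooth_sep_coframe.
- exact: psmooth_sep_kap.
- exact: sep_frameK.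
- exact: sep_coframeK.
- exact: sep_frame_off.
- exact: sep_frame_diag.
- exact: sep_coef_deriv2.
- exact: sep_kap_deriv.
- exact: sep_metricE.
Qed.

(** * Collapse of the curvature to second derivatives *)

Definition sep_vol x : R := \prod_j xGam Gam x j ^+ d j.

Definition sep_pot s x : R := A s (x s) / mu x beta ^+ (m + 1) * sep_vol x.

Definition sep_laplace s x : R :=
  mu x beta ^+ (m + 2) / (Delta x s * xGam Gam x (tag s) * sep_vol x)
    * pderiv s (pderiv s (sep_pot s)) x.

Lemma sep_volE x : sep_vol x = \prod_(s : slot d) xGam Gam x (tag s).
Proof.
transitivity (\prod_j \prod_(r < d j) xGam Gam x j).
  by apply: eq_bigr => j _; rewrite prodr_const card_ord.
rewrite (sig_big_dep predT (fun _ _ => true) (fun j (r : 'I_(d j)) => xGam Gam x j)).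
exact: eq_bigl.
Qed.

Lemma sep_vol0 x : box I x -> sep_vol x != 0.
Proof.
by move=> bx; rewrite sep_volE; apply/prodf_neq0 => s _; exact: xGam0.
Qed.

Lemma psmooth_sep_vol : psmooth I sep_vol.
Proof.
by apply: (psmooth_prod open_I) => j _; apply: (psmoothX open_I); exact: psmooth_xGam.
Qed.

Lemma psmooth_mu_betaX n : psmooth I (fun x => mu x beta ^+ n).
Proof. by apply: (psmoothX open_I); exact: psmooth_mu. Qed.

Lemma mu_betaX0 n x : box I x -> mu x beta ^+ n != 0.
Proof. by move=> bx; rewrite expf_neq0 // mu_beta0. Qed.

Lemma psmooth_sep_pot s : psmooth I (sep_pot s).
Proof.
apply: (psmoothM open_I); last exact: psmooth_sep_vol.
apply: (psmooth_div open_I); [exact: mu_betaX0|exact: psmooth_A|exact: psmooth_mu_betaX].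
Qed.

Lemma coord_sub_neq0 s u x : box I x -> tag u = tag s -> u != s -> x s - x u != 0.
Proof.
move=> bx us nus; have /prodf_neq0/(_ u) := Delta0 bx s; apply.
by rewrite us eqxx.
Qed.

Lemma pderivable_coord_sub c s u x : pderivable c (fun y : slot d -> R => y s - y u) x.
Proof. by apply: pderivableB; exact: pderivable_coord. Qed.

Lemma logd_Delta c s x : box I x -> logd c (fun y => Delta y s) x
  = \sum_(u | (tag u == tag s) && (u != s)) ((s == c)%:R - (u == c)%:R) / (x s - x u).
Proof.
move=> bx; rewrite logd_prod => [|u _|u /andP[/eqP us nus]]; last 2 first.
- exact: pderivable_coord_sub.
- exact: coord_sub_neq0.
apply: eq_bigr => u _; rewrite /logd.
by rewrite (pderivB (pderivable_coord _ _ _) (pderivable_coord _ _ _)) !pderiv_coord.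
Qed.

(** For [u != s], [Delta_u] involves [x_s] only in the factor [x_u - x_s], present when [u] and [s]
    share a group; up to sign it is a factor of [Delta_s]. *)
Lemma sum_logd_Delta s x : box I x ->
  \sum_(u | u != s) logd s (fun y => Delta y u) x = logd s (fun y => Delta y s) x.
Proof.
move=> bx; rewrite logd_Delta //.
rewrite [RHS](eq_bigl (fun u => (u != s) && (tag u == tag s))); last by move=> u; rewrite andbC.
rewrite [RHS]big_mkcondr; apply: eq_bigr => u us /=; rewrite logd_Delta //.
rewrite eqxx (negbTE us) subr0.
case: ifPn => [tus|tus].
  rewrite (bigD1 s) /=; last by rewrite eq_sym tus eq_sym us.
  rewrite eqxx [X in _ + X]big1 ?addr0 => [|v /andP[_ /negbTE ->]]; last first.
    by rewrite subrr mul0r.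
  by rewrite sub0r -[x s - x u]opprB invrN mulNr mulrN.
rewrite big1 // => v /andP[/eqP vu _].
suff /negbTE -> : v != s by rewrite subrr mul0r.
by apply: contraNneq tus => <-; rewrite vu.
Qed.

(** The missing slot [u = s] would contribute 0, as [xGam] of its own group does not contain
    [x_s]. *)
Lemma logd_sep_vol s x : box I x ->
  \sum_(u | u != s) logd s (fun y => xGam Gam y (tag u)) x = logd s sep_vol x.
Proof.
move=> bx; rewrite (_ : sep_vol = fun y => \prod_(u : slot d) xGam Gam y (tag u)); last first.
  by apply/funext => y; exact: sep_volE.
rewrite logd_prod => [|u _|u _]; last 2 first.
- exact: (psmooth_pderivable s (psmooth_xGam _) bx).
- exact: xGam0.
rewrite [RHS](bigD1 s) //= (_ : logd s (fun y => xGam Gam y (tag s)) x = 0) ?add0r //.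
by apply: logd_indep; exact: indep_xGam.
Qed.

Lemma dlog_sepE s u x : box I x -> dlog sep_coef s u x =
  logd s (fun y => Delta y u) x + logd s (fun y => xGam Gam y (tag u)) x
  - logd s (fun y => A u (y u)) x - logd s (fun y => mu y beta) x.
Proof.
move=> bx.
have dD := psmooth_pderivable s (psmooth_Delta u) bx.
have dX := psmooth_pderivable s (psmooth_xGam (tag u)) bx.
have dA := psmooth_pderivable s (psmooth_A u) bx.
have dm := psmooth_pderivable s (psmooth_mu beta) bx.
transitivity (logd s (sep_coef u) x); first by [].
rewrite (logd_div (pderivableM dD dX) (pderivableM dA dm)); last 2 first.
- exact: sep_num0.
- by rewrite mulf_neq0 ?mu_beta0 ?A_neq0.
rewrite (logdM dD dX) ?Delta0 ?xGam0 // (logdM dA dm) ?A_neq0 ?mu_beta0 //.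
by rewrite opprD addrA.
Qed.

(** The [m - 1] slots [u != s] contribute one logarithmic derivative of <mu, beta> each, and
    [sep_kap] two more. *)
Lemma lam_sepE s x : box I x -> lam sep_coef sep_kap s x =
  logd s (fun y => Delta y s) x + logd s sep_vol x - (m + 1)%:R * logd s (fun y => mu y beta) x.
Proof.
move=> bx; rewrite /lam.
have -> : \sum_(u | u != s) dlog sep_coef s u x =
  \sum_(u | u != s) (logd s (fun y => Delta y u) x + logd s (fun y => xGam Gam y (tag u)) x
    - logd s (fun y => mu y beta) x).
  apply: eq_bigr => u us; rewrite dlog_sepE // [logd s (fun y => A u (y u)) x]logd_indep ?subr0 //.
  by move=> y t; rewrite indep_coord.
rewrite sumrB big_split /= sum_logd_Delta // logd_sep_vol // sumr_const.
have -> : #|[pred u | u != s]| = m.-1 by rewrite cardC1 card_slot -hm.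
have m0 : (0 < m)%N by rewrite hm -card_slot; apply/card_gt0P; exists s.
rewrite -[in RHS](prednK m0) -[_ *+ m.-1]mulr_natl natrD -natr1 /sep_kap -mulrA -/(logd _ _ _).
by ring.
Qed.

Lemma logd_sep_pot s x : box I x -> logd s (sep_pot s) x =
  logd s (fun y => A s (y s)) x - (m + 1)%:R * logd s (fun y => mu y beta) x + logd s sep_vol x.
Proof.
move=> bx.
have dA := psmooth_pderivable s (psmooth_A s) bx.
have dm := psmooth_pderivable s (psmooth_mu beta) bx.
have dmX := psmooth_pderivable s (psmooth_mu_betaX (m + 1)) bx.
have dv := psmooth_pderivable s psmooth_sep_vol bx.
rewrite (logdM (pderivable_div (mu_betaX0 _ bx) dA dmX) dv) ?sep_vol0 //; last first.
  by rewrite mulf_neq0 ?A_neq0 // invr_neq0 // mu_betaX0.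
by rewrite (logd_div dA dmX) ?A_neq0 ?mu_betaX0 // logdX // mu_beta0.
Qed.

Lemma tau_sepE s x : box I x ->
  tau sep_coef sep_kap s x = logd s (sep_pot s) x - logd s (fun y => mu y beta) x.
Proof.
move=> bx; rewrite /tau lam_sepE // dlog_sepE // logd_sep_pot //.
rewrite [logd s (fun y => xGam Gam y (tag s)) x]logd_indep; last exact: indep_xGam.
by rewrite /sep_kap -mulrA -/(logd _ _ _); ring.
Qed.

(** With [M] = <mu, beta> and [N = sep_pot s], [tau / b] equals [Y Z] where [Y = N' M - N M'], the
    function [A s] having cancelled from [Z]. Since [M'' = 0], [Y' = N'' M]; and [lam] is minus the
    logarithmic derivative of [Z], so only [N'' M Z] remains. *)
Lemma scal_summand s x : box I x ->
  pderiv s (fun y => (sep_coef s y)^-1 * tau sep_coef sep_kap s y) x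
  + lam sep_coef sep_kap s x * ((sep_coef s x)^-1 * tau sep_coef sep_kap s x)
  = sep_laplace s x.
Proof.
move=> bx.
pose M y := mu y beta; pose N := sep_pot s.
pose Y y := pderiv s N y * M y - N y * pderiv s M y.
pose D y := Delta y s * sep_vol y * xGam Gam y (tag s).
pose Z y := M y ^+ (m + 1) / D y.
have D0 y : box I y -> D y != 0 by move=> By; rewrite !mulf_neq0 ?Delta0 ?xGam0 ?sep_vol0.
have E y : box I y -> (sep_coef s y)^-1 * tau sep_coef sep_kap s y = Y y * Z y.
  move=> By; rewrite tau_sepE // /logd /Y /Z /D -/N -/M /sep_coef /sep_num.
  have My : M y != 0 by exact: mu_beta0.
  have := mu_betaX0 (m + 1) By; rewrite -/(M y) => MX0.
  rewrite /N /sep_pot -/(M y).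
  field.
  by rewrite MX0 My sep_vol0 ?A_neq0 ?xGam0 ?Delta0.
have dM : pderivable s M x := psmooth_pderivable s (psmooth_mu beta) bx.
have dMX := psmooth_pderivable s (psmooth_mu_betaX (m + 1)) bx.
have ddM : pderivable s (pderiv s M) x := psmooth_pderivable s (psmooth_pderiv s (psmooth_mu beta)) bx.
have dN : pderivable s N x := psmooth_pderivable s (psmooth_sep_pot s) bx.
have ddN : pderivable s (pderiv s N) x := psmooth_pderivable s (psmooth_pderiv s (psmooth_sep_pot s)) bx.
have dDel := psmooth_pderivable s (psmooth_Delta s) bx.
have dv := psmooth_pderivable s psmooth_sep_vol bx.
have dX := psmooth_pderivable s (psmooth_xGam (tag s)) bx.
have dY : pderivable s Y x by apply: pderivableB; exact: pderivableM.
have dD : pderivable s D x by do 2![apply: pderivableM => //].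
have dZ : pderivable s Z x := pderivable_div (D0 _ bx) dMX dD.
have Z0 : Z x != 0 by rewrite mulf_neq0 ?mu_betaX0 // invr_neq0 // D0.
have Y' : pderiv s Y x = pderiv s (pderiv s N) x * M x.
  rewrite pderivB; [|exact: pderivableM|exact: pderivableM].
  have ddM0 : pderiv s (pderiv s M) x = 0 := pderiv2_affine x (affine_mu s beta).
  by rewrite (pderivM ddN dM) (pderivM dN ddM) ddM0; ring.
have lZ : logd s Z x = - lam sep_coef sep_kap s x.
  rewrite (logd_div dMX dD) ?mu_betaX0 ?D0 // (logdX _ dM) ?mu_beta0 //.
  rewrite (logdM (pderivableM dDel dv) dX) ?mulf_neq0 ?Delta0 ?sep_vol0 ?xGam0 //.
  rewrite (logdM dDel dv) ?Delta0 ?sep_vol0 //.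
  rewrite [logd s (fun y => xGam Gam y (tag s)) x]logd_indep; last exact: indep_xGam.
  by rewrite lam_sepE //; ring.
rewrite (pderiv_eq_box open_I _ E bx) (E _ bx) (pderivM dY dZ) Y'.
have -> : pderiv s Z x = - lam sep_coef sep_kap s x * Z x by rewrite -lZ /logd divfK.
rewrite /sep_laplace -/N (_ : (m + 2)%N = (m + 1).+1) ?exprS -/(M x); last by rewrite -addnS.
rewrite /Z /D; field.
by rewrite xGam0 ?sep_vol0 ?Delta0.
Qed.

Lemma scal_sep_laplace p : box I (base p) ->
  scal (sep_metric Gam beta e A) p = - \sum_s sep_laplace s (base p).
Proof.
by move=> bp; rewrite scal_sep //; congr (- _); apply: eq_bigr => s _; exact: scal_summand.
Qed.

(** * Extremality *)

Definition sep_scal x : R := - \sum_s sep_laplace s x.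

Definition sep_field (a : 'I_m) x : R := \sum_s sep_coframe a s x * pderiv s sep_scal x.

Lemma psmooth_sep_scal : psmooth I sep_scal.
Proof.
apply: (psmoothN open_I); apply: (psmooth_sum open_I) => s _; apply: (psmoothM open_I).
  apply: (psmooth_div open_I); [|exact: psmooth_mu_betaX|].
    by move=> x bx; rewrite !mulf_neq0 ?Delta0 ?xGam0 ?sep_vol0.
  apply: (psmoothM open_I); last exact: psmooth_sep_vol.
  exact: psmooth_sep_num.
by apply: psmooth_pderiv; apply: psmooth_pderiv; exact: psmooth_sep_pot.
Qed.

Lemma psmooth_sep_field a : psmooth I (sep_field a).
Proof.
apply: (psmooth_sum open_I) => s _; apply: (psmoothM open_I).
  exact: psmooth_sep_coframe.
by apply: psmooth_pderiv; exact: psmooth_sep_scal.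
Qed.

Let g := sep_metric Gam beta e A.

Lemma grad_scal p c : box I (base p) -> grad g (scal g) p c =
  if c is inl s then (sep_coef s (base p))^-1 * pderiv s sep_scal (base p) else 0.
Proof.
move=> bp; rewrite /grad.
have inv l : inv_metric g p c l = block_inverse sep_coef (frame_cogram sep_coef sep_coframe) c l (base p).
  apply: (@inv_block_metric _ _ m I g sep_coef (frame_gram sep_coef sep_frame)) => //.
  - exact: sep_coef0.
  - exact: (frame_gramK sep_coef0 sep_frameK sep_coframeK).
  - exact: sep_metricE.
have dscal l : pderiv l (scal g) p = pderiv_base l sep_scal (base p).
  by apply: (@pderiv_baseE _ _ _ _ open_I l (scal g) sep_scal p) => // q; exact: scal_sep_laplace.
rewrite big_sumType /= [X in _ + X]big1 ?addr0 => [|a _]; last by rewrite dscal mulr0.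
case: c inv => [s|a] inv.
  rewrite (bigD1 s) //= big1 ?addr0 => [|u us]; rewrite inv /=.
    by rewrite eqxx mul1r dscal.
  by rewrite eq_sym (negbTE us) !mul0r.
by rewrite big1 // => u _; rewrite inv mul0r.
Qed.

Lemma killing_potential_base p s : box I (base p) ->
  cplx_vect (sep_geometry Gam beta e A) (grad g (scal g)) p (inl s) = 0.
Proof.
move=> bp; rewrite /cplx_vect big_sumType /= !big1 ?addr0 ?oppr0 // => [a _|u _].
  by rewrite grad_scal // mulr0.
by rewrite mulr0 mul0r.
Qed.

(** The factor [1 / A_s] in [J dt] cancels the [A_s] in [1 / b_s] from the gradient; what is left is
    [sep_coframe]. *)
Lemma killing_potential_fiber p a : box I (base p) ->
  cplx_vect (sep_geometry Gam beta e A) (grad g (scal g)) p (inr a) = sep_field a (base p).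
Proof.
move=> bp; rewrite /cplx_vect big_sumType /= [X in _ + X]big1 ?addr0 => [|c _]; last first.
  by rewrite grad_scal // mulr0.
rewrite -sumrN; apply: eq_bigr => u _; rewrite grad_scal // (bigD1 u) //= big1 ?addr0.
  rewrite /dx eqxx mulr1 /sep_coframe /psi_coord /sep_coef -/(base p).
  have := A_neq0 u bp; have := mu_beta0 bp; have := sep_num0 u bp => n0 m0 a0.
  have xp : xpart p = base p by [].
  rewrite xp; field.
  by rewrite n0 m0 a0.
by move=> v vu; rewrite /dx (inj_eq (@inl_inj _ _)) eq_sym (negbTE vu) mulr0.
Qed.

Lemma extremal_field_constant : extremal (sep_domain (m := m) I) (sep_geometry Gam beta e A) <->
  forall s a x, box I x -> pderiv s (sep_field a) x = 0.
Proof.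
apply: (@killing_vertical _ _ m I open_I g sep_coef (frame_gram sep_coef sep_frame)
  (frame_cogram sep_coef sep_coframe)) => //.
- exact: (frame_gramK sep_coef0 sep_frameK sep_coframeK).
- exact: sep_metricE.
- by move=> p s; exact: killing_potential_base.
- by move=> p a; exact: killing_potential_fiber.
Qed.

(** Inverts the definition of [sep_field]: as [sep_frame u a] is the [x_u]-derivative of <mu_beta,
    e_a>, the field components are the coefficients of d Scal in these differentials. *)
Lemma sep_frame_field u x : box I x ->
  \sum_a sep_frame u a x * sep_field a x = pderiv u sep_scal x.
Proof.
move=> bx; under eq_bigr do rewrite mulr_sumr.
rewrite exchange_big (bigD1 u) //= [X in _ + X]big1 ?addr0 => [|s su].
  under eq_bigr do rewrite mulrA.
  by rewrite -mulr_suml sep_frameK // eqxx mul1r.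
under eq_bigr do rewrite mulrA.
by rewrite -mulr_suml sep_frameK // eq_sym (negbTE su) mul0r.
Qed.

Hypothesis interval_I : forall s, is_interval (I s).
Hypothesis beta_in : beta \in fact_space Gam.

(* If sep_field is the constant z, then sep_scal - \sum_a z a * <mu_beta, e_a> has zero gradient. *)
Lemma field_constant_iff : (forall s a x, box I x -> pderiv s (sep_field a) x = 0) <->
  exists2 v, v \in fact_space Gam & forall x, box I x -> sep_scal x = affine_coord v x.
Proof.
split=> [Z0|[v vh vE] s a x bx]; last first.
  rewrite -[RHS](pderiv_cst s (coord_mod_beta beta e a v) x).
  apply: (pderiv_eq_box open_I _ _ bx) => y By.
  transitivity (\sum_t sep_coframe a t y * \sum_c coord_mod_beta beta e c v * sep_frame t c y).
    apply: eq_bigr => t _; rewrite (pderiv_eq_box open_I _ vE By).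
    by rewrite pderiv_affine_coord_expand.
  under eq_bigr do rewrite mulr_sumr.
  rewrite exchange_big (bigD1 a) //= [X in _ + X]big1 ?addr0 => [|c ca].
    under eq_bigr do rewrite mulrCA.
    by rewrite -mulr_sumr sep_coframeK // eqxx mulr1.
  under eq_bigr do rewrite mulrCA.
  by rewrite -mulr_sumr sep_coframeK // eq_sym (negbTE ca) mulr0.
(* The integration constants are read off at a base point; over an empty box any vector will do. *)
have [[x0 bx0]|nobox] := pselect (exists x, box I x); last first.
  exists 0; first exact: mem0v.
  by move=> x bx; case: nobox; exists x.
pose z a := sep_field a x0.
have zE a x : box I x -> sep_field a x = z a.
  move=> bx; apply: (constant_on_box interval_I _ bx bx0) => s y By.
  by split; [exact: (psmooth_pderivable s (psmooth_sep_field a) By)|exact: Z0].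
pose F x := sep_scal x - \sum_a z a * affine_coord (tnth e a) x.
have cF x : box I x -> F x = F x0.
  move=> bx; apply: (constant_on_box interval_I _ bx bx0) => s y By.
  have ds := psmooth_pderivable s psmooth_sep_scal By.
  have da a := psmooth_pderivable s (psmooth_affine_coord (tnth e a)) By.
  have dz : pderivable s (fun y => \sum_a z a * affine_coord (tnth e a) y) y.
    by apply: pderivable_sum => a _; exact: pderivableZ.
  split; first exact: pderivableB.
  rewrite (pderivB ds dz) pderiv_sum => [|a _]; last exact: pderivableZ.
  rewrite -sep_frame_field // -sumrB big1 // => a _.
  by rewrite (pderivZ _ (da a)) zE // mulrC subrr.
(* As <mu_beta, beta> = 1, the integration constant becomes the coefficient of [beta]. *)
exists (F x0 *: beta + \sum_a z a *: tnth e a).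
  apply: memvD; first exact: memvZ.
  by apply: memv_suml => a _; apply: memvZ; exact: (mem_basis_h he).
move=> x bx; rewrite /affine_coord muD muZ mu_sum mulrDl mulfK ?mu_beta0 // -(cF _ bx) /F.
rewrite mulr_suml -[LHS](subrK (\sum_a z a * affine_coord (tnth e a) x)); congr (_ + _).
by apply: eq_bigr => a _; rewrite muZ mulrA.
Qed.

Lemma sum_sep_laplace x : box I x ->
  \sum_s mu x beta ^+ (m + 3) / (Delta x s * xGam Gam x (tag s) * sep_vol x)
    * pderiv s (pderiv s (sep_pot s)) x = - (sep_scal x * mu x beta).
Proof.
move=> bx; rewrite mulNr opprK mulr_suml; apply: eq_bigr => s _.
by rewrite /sep_laplace (_ : (m + 3)%N = (m + 2).+1) ?exprS; [ring|rewrite -addnS].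
Qed.

Lemma extremal_iff_momentum :
  extremal (sep_domain (m := m) I) (sep_geometry Gam beta e A) <->
  exists2 alpha, alpha \in fact_space Gam & forall x, box I x ->
    \sum_s mu x beta ^+ (m + 3) / (Delta x s * xGam Gam x (tag s) * sep_vol x)
      * pderiv s (pderiv s (sep_pot s)) x = mu x alpha.
Proof.
have muN x v : mu x (- v) = - mu x v by rewrite -scaleN1r muZ mulN1r.
rewrite extremal_field_constant field_constant_iff.
(* The sum in question is - Scal times <mu, beta>, whence [alpha = - v] in both directions. *)
split=> -[v vh vE]; exists (- v); rewrite ?memvN // => x bx.
  by rewrite sum_sep_laplace // vE // muN divfK // mu_beta0.
by rewrite /affine_coord muN -vE // sum_sep_laplace // opprK mulfK // mu_beta0.
Qed.

End SeparableGeometry.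

Unset Implicit Arguments.

Theorem theorem2p6p1 (R : realType) (k : nat) (d : 'I_k -> nat) (m : nat)
  (hd : forall j, (0 < d j)%N)
  (hm : m = (\sum_(j < k) d j)%N)
  (hm2 : (2 <= m)%N)
  (Gam : forall j, tensor R (offslot d j))
  (hGam0 : forall j, Gam j != 0)
  (hGam1 : k = 1%N -> forall j, Gam j = [ffun=> 1])
  (hdim : \dim (fact_space Gam) = m.+1)
  (beta : tensor R (slot d))
  (hbeta : beta \in fact_space Gam)
  (hbeta0 : beta != 0)
  (e : m.-tuple (tensor R (slot d)))
  (he : basis_of (fact_space Gam) (beta :: e))
  (I : slot d -> set R)
  (hIo : forall s, open (I s))
  (hIi : forall s, is_interval (I s))
  (hDelta : forall x : slot d -> R, (forall s, I s (x s)) ->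
     forall s, Delta x s != 0)
  (hxGam : forall x : slot d -> R, (forall s, I s (x s)) ->
     forall j, xGam Gam x j != 0)
  (hmu : forall x : slot d -> R, (forall s, I s (x s)) -> mu x beta != 0)
  (A : slot d -> R -> R)
  (hAsmooth : forall s, smooth_on (I s) (A s))
  (hA0 : forall s y, I s y -> A s y != 0)
  (hpos : forall p, sep_domain (m := m) I p ->
     posdef (metric (sep_geometry Gam beta e A)) p) :
  (forall p, sep_domain (m := m) I p ->
     let x := xpart p in
     scal (metric (sep_geometry Gam beta e A)) p =
     - \sum_(s : slot d)
         mu x beta ^+ (m + 2)
         / (Delta x s * xGam Gam x (tag s)
            * \prod_(j < k) xGam Gam x j ^+ d j)
         * pderiv s (pderiv s (fun y =>
             A s (y s) / mu y beta ^+ (m + 1)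
             * \prod_(j < k) xGam Gam y j ^+ d j)) x)
  /\
  (extremal (sep_domain (m := m) I) (sep_geometry Gam beta e A)
   <->
   exists2 alpha, alpha \in fact_space Gam &
     forall x : slot d -> R, (forall s, I s (x s)) ->
       \sum_(s : slot d)
         mu x beta ^+ (m + 3)
         / (Delta x s * xGam Gam x (tag s)
            * \prod_(j < k) xGam Gam x j ^+ d j)
         * pderiv s (pderiv s (fun y =>
             A s (y s) / mu y beta ^+ (m + 1)
             * \prod_(j < k) xGam Gam y j ^+ d j)) x
       = mu x alpha).

Proof.
split=> [p bp|].
  exact: (scal_sep_laplace hm he hIo hDelta hxGam hmu hAsmooth hA0 (p := p) bp).
exact: (extremal_iff_momentum hm he hIo hDelta hxGam hmu hAsmooth hA0 hIi hbeta).
Qed.
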